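(* Let $M$ be a non-Einstein and non-conformally flat hypersurface in a semi-Riemannian space of constant curvature $N_{s}^{n+1}(c)$, $n\geq 4$, with second fundamental tensor $H$. Let $\widetilde{\kappa}$ be the scalar curvature of $N_s^{n+1}(c)$, and let ${\mathcal U}_{H}\subset M$ be the set of all points at which $H^{2}$ is not a linear combination of $g$ and $H$. Assume that on ${\mathcal U}_{H}$ $$H^{3}=\mathrm{tr}(H)\, H^{2}+\psi\, H+\rho\, g,$$ where $\psi$ and $\rho$ are some functions on ${\mathcal U}_{H}$, and let $T_{1},T_{2},T_{3}$ be generalized curvature tensors defined on ${\mathcal U}_{H}$. Let $$E=g\wedge S^{2}+\frac{n-2}{2}\, S\wedge S-\kappa\, g\wedge S+\frac{\kappa^{2}-\mathrm{tr}_{g}(S^{2})}{2(n-1)}\, g\wedge g.$$ (1) If $R\cdot C=Q(g,T_{1})$ on ${\mathcal U}_{H}$, then on ${\mathcal U}_{H}$ $$\mathrm{Weyl}(T_{1})=\left(\frac{\kappa+\varepsilon\psi}{n-1}-\frac{(n-1)\widetilde{\kappa}}{n(n+1)}\right)C-\frac{1}{(n-2)(n-1)}\, E.$$ (2) If $C\cdot R=Q(g,T_{2})$ on ${\mathcal U}_{H}$, then on ${\mathcal U}_{H}$ $$\mathrm{Weyl}(T_{2})=\left(\frac{\kappa+2\varepsilon\psi}{n-1}-\frac{\widetilde{\kappa}}{n+1}\right)C-\frac{n-3}{(n-2)^{2}(n-1)}\, E.$$ (3) If $R\cdot C-C\cdot R=Q(g,T_{3})$ on ${\mathcal U}_{H}$,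 then on ${\mathcal U}_{H}$ $$\mathrm{Weyl}(T_{3})=\left(\frac{\widetilde{\kappa}}{n(n+1)}-\frac{\varepsilon\psi}{n-1}\right)C-\frac{1}{(n-2)^{2}(n-1)}\, E.$$
   Context: Manifolds are connected, paracompact, of class $C^\infty$; metrics are nondegenerate of arbitrary signature. $N_{s}^{n+1}(c)$ is a semi-Riemannian space of constant curvature $c=\frac{\widetilde{\kappa}}{n(n+1)}$ with signature $(s,n+1-s)$ and scalar curvature $\widetilde{\kappa}$. $M$, $\dim M=n$, is a connected hypersurface isometrically immersed in $N_s^{n+1}(c)$; $g,R,S,\kappa,C$ denote its (semi-Riemannian) metric tensor, Riemann-Christoffel curvature tensor, Ricci tensor, scalar curvature and Weyl conformal curvature tensor, and $H$ its second fundamental tensor, so that the Gauss equation reads $R-\frac{\widetilde{\kappa}}{2n(n+1)}\, g\wedge g=\frac{\varepsilon}{2}\, H\wedge H$ with $\varepsilon=\pm1$. Here $\mathrm{tr}(H)$ is the trace with respect to $g$; with $g({\mathcal H}X,Y)=H(X,Y)$, $H^{2}(X,Y)=H({\mathcal H}X,Y)$ and $H^{3}(X,Y)=H^{2}({\mathcal H}X,Y)$. Conventions: ${\mathcal R}(X,Y)Z=\nabla_X\nabla_YZ-\nabla_Y\nabla_XZ-\nabla_{[X,Y]}Z$, $R(X_1,X_2,X_3,X_4)=g({\mathcal R}(X_1,X_2)X_3,X_4)$, $S(X,Y)=\mathrm{tr}\{Z\mapsto{\mathcal R}(Z,X)Y\}$, $g({\mathcal S}X,Y)=S(X,Y)$,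 $\kappa=\mathrm{tr}\,{\mathcal S}$, $S^{2}(X,Y)=S({\mathcal S}X,Y)$. The Kulkarni-Nomizu product of symmetric $(0,2)$-tensors $A,B$ is $$(A\wedge B)(X_1,X_2,X_3,X_4)=A(X_1,X_4)B(X_2,X_3)+A(X_2,X_3)B(X_1,X_4)-A(X_1,X_3)B(X_2,X_4)-A(X_2,X_4)B(X_1,X_3),$$ and $C=R-\frac{1}{n-2}\, g\wedge S+\frac{\kappa}{2(n-2)(n-1)}\, g\wedge g$. A generalized curvature tensor is a $(0,4)$-tensor $T(X_1,X_2,X_3,X_4)=g({\mathcal T}(X_1,X_2)X_3,X_4)$, with each ${\mathcal T}(X,Y)$ a skew-symmetric endomorphism, such that $T(X_1,X_2,X_3,X_4)=T(X_3,X_4,X_1,X_2)$ and $T(X_1,X_2,X_3,X_4)+T(X_2,X_3,X_1,X_4)+T(X_3,X_1,X_2,X_4)=0$. Its Ricci tensor is $\mathrm{Ric}(T)(X,Y)=\mathrm{tr}\{Z\mapsto{\mathcal T}(Z,X)Y\}$, its scalar curvature is $\kappa(T)=\mathrm{tr}_g(\mathrm{Ric}(T))$, and its Weyl tensor is $\mathrm{Weyl}(T)=T-\frac{1}{n-2}\, g\wedge\mathrm{Ric}(T)+\frac{\kappa(T)}{2(n-2)(n-1)}\, g\wedge g$. For a $(0,4)$-tensor $B(X_1,X_2,X_3,X_4)=g({\mathcal B}(X_1,X_2)X_3,X_4)$ with each ${\mathcal B}(X,Y)$ a skew-symmetric endomorphism, and a $(0,k)$-tensor $T$, $k\ge1$,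 $$(B\cdot T)(X_1,\ldots,X_k,X,Y)=-T({\mathcal B}(X,Y)X_1,X_2,\ldots,X_k)-\cdots-T(X_1,\ldots,X_{k-1},{\mathcal B}(X,Y)X_k).$$ For a symmetric $(0,2)$-tensor $A$, put $(X\wedge_AY)Z=A(Y,Z)X-A(X,Z)Y$ and $$Q(A,T)(X_1,\ldots,X_k,X,Y)=-T((X\wedge_AY)X_1,X_2,\ldots,X_k)-\cdots-T(X_1,\ldots,X_{k-1},(X\wedge_AY)X_k).$$ *)

(* Defs.v *)
From HB Require Import structures.
From mathcomp Require Import all_boot all_order all_algebra.
From mathcomp Require Import all_classical all_reals all_analysis.

Set Implicit Arguments.
Unset Strict Implicit.
Unset Printing Implicit Defensive.

Import Order.TTheory GRing.Theory Num.Theory.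
Import numFieldNormedType.Exports.
Local Open Scope classical_set_scope.
Local Open Scope ring_scope.

(* Covariant tensors are functions of vectors of 'rV[K]_n; multilinearity is
   required separately where it is not automatic. *)

Section TensorAlgebra.
Variables (K : fieldType) (n : nat).

Local Notation V := 'rV[K]_n.

Definition tensor2 := V -> V -> K.
Definition tensor4 := V -> V -> V -> V -> K.
Definition tensor6 := V -> V -> V -> V -> V -> V -> K.

Definition basisv (i : 'I_n) : V := delta_mx 0 i.

Definition form (G : 'M[K]_n) : tensor2 := fun X Y => (X *m G *m Y^T) 0 0.

Definition gram (g : tensor2) : 'M[K]_n :=
  \matrix_(i, j) g (basisv i) (basisv j).

(* For phi linear and g nondegenerate, the vector u with g(u, Y) = phi(Y). *)
Definition sharp (g : tensor2) (phi : V -> K) : V :=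
  (\row_j phi (basisv j)) *m invmx (gram g).

(* The endomorphism a with g(a X, Y) = A(X, Y). *)
Definition endo (g A : tensor2) (X : V) : V := sharp g (A X).

(* The endomorphism b(X, Y) with g(b(X, Y) Z, W) = B(X, Y, Z, W). *)
Definition curv_endo (g : tensor2) (B : tensor4) (X Y Z : V) : V :=
  sharp g (B X Y Z).

Definition trace (F : V -> V) : K := \tr (lin1_mx F).

Definition tr2 (g A : tensor2) : K := trace (endo g A).

Definition pow2 (g A : tensor2) : tensor2 := fun X Y => A (endo g A X) Y.
Definition pow3 (g A : tensor2) : tensor2 :=
  fun X Y => pow2 g A (endo g A X) Y.

Definition kn (A B : tensor2) : tensor4 := fun X1 X2 X3 X4 =>
  A X1 X4 * B X2 X3 + A X2 X3 * B X1 X4 - A X1 X3 * B X2 X4 - A X2 X4 * B X1 X3.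

Definition ricci (g : tensor2) (T : tensor4) : tensor2 :=
  fun X Y => trace (fun Z => curv_endo g T Z X Y).

Definition scal (g : tensor2) (T : tensor4) : K := tr2 g (ricci g T).

Definition weyl (g : tensor2) (T : tensor4) : tensor4 := fun X1 X2 X3 X4 =>
  T X1 X2 X3 X4
  - (n%:R - 2)^-1 * kn g (ricci g T) X1 X2 X3 X4
  + scal g T / (2 * (n%:R - 2) * (n%:R - 1)) * kn g g X1 X2 X3 X4.

Definition multilinear4 (T : tensor4) : Prop :=
  forall (a : K) (X Y X1 X2 X3 X4 : V),
  [/\ T (a *: X + Y) X2 X3 X4 = a * T X X2 X3 X4 + T Y X2 X3 X4,
      T X1 (a *: X + Y) X3 X4 = a * T X1 X X3 X4 + T X1 Y X3 X4,
      T X1 X2 (a *: X + Y) X4 = a * T X1 X2 X X4 + T X1 X2 Y X4 &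
      T X1 X2 X3 (a *: X + Y) = a * T X1 X2 X3 X + T X1 X2 X3 Y].

(* The first clause after multilinearity says that every curv_endo g T X1 X2 is
   skew-symmetric with respect to g. *)
Definition gen_curvature_tensor (T : tensor4) : Prop :=
  [/\ multilinear4 T,
      forall X1 X2 X3 X4, T X1 X2 X3 X4 = - T X1 X2 X4 X3,
      forall X1 X2 X3 X4, T X1 X2 X3 X4 = T X3 X4 X1 X2 &
      forall X1 X2 X3 X4,
        T X1 X2 X3 X4 + T X2 X3 X1 X4 + T X3 X1 X2 X4 = 0].

Definition derivation4 (b : V -> V -> V -> V) (T : tensor4) : tensor6 :=
  fun X1 X2 X3 X4 X Y =>
  - T (b X Y X1) X2 X3 X4 - T X1 (b X Y X2) X3 X4
  - T X1 X2 (b X Y X3) X4 - T X1 X2 X3 (b X Y X4).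

(* B . T *)
Definition curv_dot (g : tensor2) (B T : tensor4) : tensor6 :=
  derivation4 (curv_endo g B) T.

(* X /\_A Y *)
Definition wedge_endo (A : tensor2) (X Y Z : V) : V := A Y Z *: X - A X Z *: Y.

(* Q(A, T) *)
Definition tachibana (A : tensor2) (T : tensor4) : tensor6 :=
  derivation4 (wedge_endo A) T.

Definition tensorE (g S : tensor2) : tensor4 := fun X1 X2 X3 X4 =>
  kn g (pow2 g S) X1 X2 X3 X4
  + (n%:R - 2) / 2 * kn S S X1 X2 X3 X4
  - tr2 g S * kn g S X1 X2 X3 X4
  + (tr2 g S ^+ 2 - tr2 g (pow2 g S)) / (2 * (n%:R - 1)) * kn g g X1 X2 X3 X4.

End TensorAlgebra.

Section LocalCalculus.
Variables (R : realType).

Definition partial (n : nat) (W : normedModType R) (i : 'I_n)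
    (f : 'rV[R]_n -> W) : 'rV[R]_n -> W :=
  fun u => 'D_(basisv R i) f u.

(* On an open set U this is C^oo: all iterated partial derivatives exist and
   are (Frechet) differentiable, hence continuous, at each point of U. *)
Definition smooth_on (n : nat) (W : normedModType R) (U : set 'rV[R]_n)
    (f : 'rV[R]_n -> W) : Prop :=
  forall (s : seq 'I_n) (u : 'rV[R]_n), U u ->
    differentiable (foldr (@partial n W) f s) u.

Section Metric.
Variables (n : nat) (G : 'rV[R]_n -> 'M[R]_n).

Definition dmetric (i j k : 'I_n) (u : 'rV[R]_n) : R :=
  partial i (fun v => G v j k) u.

(* Gamma^k_ij *)
Definition christoffel (i j k : 'I_n) (u : 'rV[R]_n) : R :=
  2^-1 * \sum_l invmx (G u) k l *
    (dmetric i j l u + dmetric j i l u - dmetric l i j u).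

(* The d_l-component of R(d_i, d_j) d_k, where
   R(X, Y) = nabla_X nabla_Y - nabla_Y nabla_X - nabla_[X, Y]. *)
Definition riemann_coef (i j k l : 'I_n) (u : 'rV[R]_n) : R :=
  partial i (christoffel j k l) u - partial j (christoffel i k l) u
  + \sum_m (christoffel j k m u * christoffel i m l u
            - christoffel i k m u * christoffel j m l u).

(* R(X1, X2, X3, X4) = g(R(X1, X2) X3, X4) at the point u. *)
Definition riemann_at (u : 'rV[R]_n) : tensor4 R n := fun X1 X2 X3 X4 =>
  form (G u)
    (\row_l \sum_i \sum_j \sum_k
       X1 0 i * X2 0 j * X3 0 k * riemann_coef i j k l u) X4.

End Metric.
End LocalCalculus.

Definition paracompact_space (T : topologicalType) : Prop :=
  forall C : set (set T),
    (forall O, C O -> open O) -> \bigcup_(O in C) O = setT ->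
  exists D : set (set T),
    [/\ forall O, D O -> open O,
        \bigcup_(O in D) O = setT,
        forall O, D O -> exists2 O', C O' & O `<=` O' &
        forall x : T, exists2 W, nbhs x W &
          finite_set (D `&` [set O | (O `&` W) !=set0])].

Record chart (R : realType) (n : nat) (T : topologicalType) := Chart {
  cdom : set T;
  ccod : set 'rV[R]_n;
  cmap : T -> 'rV[R]_n;
  cinv : 'rV[R]_n -> T;
  cdom_open : open cdom;
  ccod_open : open ccod;
  cmap_in : forall x, cdom x -> ccod (cmap x);
  cinv_in : forall u, ccod u -> cdom (cinv u);
  cmapK : forall x, cdom x -> cinv (cmap x) = x;
  cinvK : forall u, ccod u -> cmap (cinv u) = u;
  cmap_cont : forall x, cdom x -> {for x, continuous cmap};
  cinv_cont : forall u, ccod u -> {for u, continuous cinv} }.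

(* A smooth structure is given by an atlas indexed by the points: chart_at x is
   a chart around x.  The tangent space at x is 'rV[R]_n, a vector being given
   by its components in the coordinate basis of chart_at x. *)
Record manifold (R : realType) (n : nat) := Manifold {
  mpoint :> topologicalType;
  chart_at : mpoint -> chart R n mpoint;
  chart_at_dom : forall x, cdom (chart_at x) x;
  chart_smooth : forall x y,
    smooth_on [set u | ccod (chart_at x) u
                       /\ cdom (chart_at y) (cinv (chart_at x) u)]
              (cmap (chart_at y) \o cinv (chart_at x));
  mhausdorff : hausdorff_space mpoint;
  mparacompact : paracompact_space mpoint;
  mconnected : connected [set: mpoint] }.

Definition coord (R : realType) (n : nat) (M : manifold R n) (x : M) :
  'rV[R]_n := cmap (chart_at x) x.

(* The local expression of f : M -> N in the charts around x and y. *)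
Definition local_rep (R : realType) (m n : nat) (M : manifold R m)
    (N : manifold R n) (f : M -> N) (x : M) (y : N) : 'rV[R]_m -> 'rV[R]_n :=
  cmap (chart_at y) \o f \o cinv (chart_at x).

Definition local_dom (R : realType) (m n : nat) (M : manifold R m)
    (N : manifold R n) (f : M -> N) (x : M) (y : N) : set 'rV[R]_m :=
  [set u | ccod (chart_at x) u
           /\ cdom (chart_at y) (f (cinv (chart_at x) u))].

(* mcomp x u is the matrix of components at the point of coordinates u in
   chart_at x. 'J f u has entries (i, j) |-> d_i f_j. *)
Record metric (R : realType) (n : nat) (M : manifold R n) := Metric {
  mcomp : M -> 'rV[R]_n -> 'M[R]_n;
  mcomp_smooth : forall x, smooth_on (ccod (chart_at x)) (mcomp x);
  mcomp_sym : forall x u, ccod (chart_at x) u -> (mcomp x u)^T = mcomp x u;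
  mcomp_unit : forall x u, ccod (chart_at x) u -> mcomp x u \in unitmx;
  mcomp_change : forall x y u, local_dom (@id M) x y u ->
    let tau := local_rep (@id M) x y in
    mcomp x u = 'J tau u *m mcomp y (tau u) *m ('J tau u)^T }.

Section Curvature.
Variables (R : realType) (n : nat) (M : manifold R n) (G : metric M).

Definition metric_at (x : M) : tensor2 R n := form (mcomp G x (coord x)).

Definition curvature (x : M) : tensor4 R n := riemann_at (mcomp G x) (coord x).

Definition ricci_curvature (x : M) : tensor2 R n :=
  ricci (metric_at x) (curvature x).

Definition scalar_curvature (x : M) : R := scal (metric_at x) (curvature x).

Definition weyl_curvature (x : M) : tensor4 R n :=
  weyl (metric_at x) (curvature x).

Definition einstein : Prop := forall x X Y,
  ricci_curvature x X Y = scalar_curvature x / n%:R * metric_at x X Y.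

Definition conformally_flat : Prop := forall x : M,
  exists (U : set 'rV[R]_n) (sigma : 'rV[R]_n -> R),
    [/\ open U, U (coord x) & U `<=` ccod (chart_at x)] /\
    [/\ smooth_on U sigma, forall u, U u -> 0 < sigma u &
        forall u, U u -> forall X1 X2 X3 X4,
          riemann_at (fun v => sigma v *: mcomp G x v) u X1 X2 X3 X4 = 0].

Definition constant_curvature (c : R) : Prop := forall x X1 X2 X3 X4,
  curvature x X1 X2 X3 X4
  = c / 2 * kn (metric_at x) (metric_at x) X1 X2 X3 X4.

(* The rows of P form an orthonormal basis with s timelike vectors and
   n - s spacelike ones. *)
Definition has_signature (s : nat) : Prop := (s <= n)%N /\
  forall x : M, exists2 P : 'M[R]_n, P \in unitmx &
    P *m gram (metric_at x) *m P^T
    = diag_mx (\row_(i < n) if (i < s)%N then -1 else 1).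

End Curvature.

Section Hypersurface.
Variables (R : realType) (n : nat) (M : manifold R n) (N : manifold R n.+1).
Variables (g : metric M) (gN : metric N) (f : M -> N).

(* As g is nondegenerate, such an f is automatically an immersion. *)
Definition isometric_immersion : Prop :=
  continuous f /\
  forall (x : M) (y : N),
    smooth_on (local_dom f x y) (local_rep f x y) /\
    forall u, local_dom f x y u ->
      let F := local_rep f x y in
      mcomp g x u = 'J F u *m mcomp gN y (F u) *m ('J F u)^T.

Definition tangent_map (x : M) : 'rV[R]_n -> 'rV[R]_n.+1 :=
  fun X => X *m 'J (local_rep f x (f x)) (coord x).

(* xi x is a unit vector in the tangent space of N at f x, normal to M.  No
   choice of signs, continuous or not, is imposed on x |-> xi x. *)
Definition unit_normal (xi : M -> 'rV[R]_n.+1) (eps : R) : Prop :=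
  forall x : M,
    (forall X, metric_at gN (f x) (xi x) (tangent_map x X) = 0) /\
    metric_at gN (f x) (xi x) (xi x) = eps.

(* The derivative along f, in direction d_i, of the vector field f_* d_j for the
   Levi-Civita connection of N. *)
Definition ambient_derivative (x : M) (i j : 'I_n) : 'rV[R]_n.+1 :=
  let F := local_rep f x (f x) in
  let u := coord x in
  \row_a (partial i (partial j F) u 0 a
          + \sum_b \sum_c christoffel (mcomp gN (f x)) b c a (F u)
              * partial i F u 0 b * partial j F u 0 c).

(* H(X, Y) = gN(nabla_X f_* Y, xi), i.e. the Gauss formula is
   nabla^N_X Y = nabla_X Y + eps H(X, Y) xi. *)
Definition second_fundamental (xi : M -> 'rV[R]_n.+1) (x : M) : tensor2 R n :=
  fun X Y => \sum_i \sum_j X 0 i * Y 0 j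
     * metric_at gN (f x) (ambient_derivative x i j) (xi x).

End Hypersurface.

Definition UH (R : realType) (n : nat) (M : manifold R n) (g : metric M)
    (H : M -> tensor2 R n) : set M :=
  [set x | ~ exists a b : R, forall X Y,
     pow2 (metric_at g x) (H x) X Y = a * metric_at g x X Y + b * H x X Y].

(* Main.v *)
Require Import Defs.
From mathcomp Require Import all_boot all_order all_algebra.
From mathcomp Require Import all_classical all_reals all_analysis.
From mathcomp Require Import ring lra.

Set Implicit Arguments.
Unset Strict Implicit.
Unset Printing Implicit Defensive.

Import Order.TTheory GRing.Theory Num.Theory.
Import numFieldNormedType.Exports.
Local Open Scope classical_set_scope.
Local Open Scope ring_scope.

(* Everything reduces to pointwise algebra once the Gauss equation
   [R = c/2 g/\g + eps/2 H/\H] is established from the immersion; it follows by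
   writing the lowered curvature tensor of a metric through its second
   derivatives and comparing the 2-jets of [g] and of the ambient metric.

   Put [A = tr(H) H - H^2], so that [S = eps A + (n-1) c g]; the cubic equation
   for [H] says exactly that [A(HX, Y) = - psi H(X, Y) - rho g(X, Y)].  Contracting
   [Q(g, T)] in its first and last arguments gives [-(n-1) T] up to [g /\ Ric(T)],
   hence [Q(g, T)] determines [T] modulo tensors [g /\ B], which the Weyl
   operator kills.  Contracting [R.C] and [C.R] produces only [A /\ A], [H /\ H]
   and tensors [g /\ B]; since [Weyl(A /\ A) = 2/(n-2) E] and
   [eps/2 Weyl(H /\ H) = C], the coefficients can be read off. *)

(** The normal [xi] is prescribed point by point without any regularity, so it cannot be
    differentiated and the Weingarten formula is out of reach. The Gauss equation is therefore drawn
    from the derivatives of the induced metric, which involve the immersion up to third order; [xi]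
    enters only when the ambient metric at the point is split into tangential and normal parts.

    In the algebra, [endoH] and [endoA] acting on [half_kn] are the only terms not of the form
    [Q(g, .)]. Their coefficients [(al, be)] are [(1, 0)] for [R.C], [(1, -1/(n-2))] for [C.R] and
    hence [(0, 1/(n-2))] for the commutator. Both actions contribute the same multiple of [A /\ A],
    so [E] gets the coefficient [-(al + be)/((n-1)(n-2))]; the sums [1], [(n-3)/(n-2)] and [1/(n-2)]
    explain the three constants of the theorem. As [eps^2 = 1], [A /\ A] and [S /\ S] differ by some
    [g /\ B], so [E] can be formed from [S] with no sign left. *)

Local Notation form := Defs.form.
Local Notation coord := Defs.coord.

(** * Bilinear forms in coordinates *)

Section Forms.
Variables (K : fieldType) (n : nat).
Implicit Types (M : 'M[K]_n) (X Y Z : 'rV[K]_n).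

Lemma formE M X Y : form M X Y = \sum_i \sum_j X 0 i * M i j * Y 0 j.
Proof.
rewrite /form mxE exchange_big /=; apply: eq_bigr => j _.
by rewrite !mxE mulr_suml; apply: eq_bigr.
Qed.

Lemma formDl M X X' Y : form M (X + X') Y = form M X Y + form M X' Y.
Proof. by rewrite /form !mulmxDl mxE. Qed.

Lemma formZl M a X Y : form M (a *: X) Y = a * form M X Y.
Proof. by rewrite /form -!scalemxAl mxE. Qed.

Lemma formNl M X Y : form M (- X) Y = - form M X Y.
Proof. by rewrite /form !mulNmx mxE. Qed.

Lemma formDr M X Y Y' : form M X (Y + Y') = form M X Y + form M X Y'.
Proof. by rewrite /form linearD /= mulmxDr mxE. Qed.

Lemma formZr M a X Y : form M X (a *: Y) = a * form M X Y.
Proof. by rewrite /form linearZ /= -scalemxAr mxE. Qed.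

Lemma form_sym M X Y : M^T = M -> form M X Y = form M Y X.
Proof.
move=> sM; rewrite /form.
have -> : X *m M *m Y^T = (Y *m M *m X^T)^T; last by rewrite mxE.
by rewrite !trmx_mul trmxK sM mulmxA.
Qed.

Lemma form_basis M i j : form M (basisv K i) (basisv K j) = M i j.
Proof. by rewrite /form -rowE trmx_delta -colE !mxE. Qed.

Lemma form_basisr M X j : form M X (basisv K j) = (X *m M) 0 j.
Proof. by rewrite /form trmx_delta -colE mxE. Qed.

Lemma form_row M m (J : 'M[K]_(m, n)) X i : form M X (row i J) = (X *m M *m J^T) 0 i.
Proof. by rewrite /form rowE trmx_mul trmx_delta mulmxA -colE mxE. Qed.

Lemma formDm M N X Y : form (M + N) X Y = form M X Y + form N X Y.
Proof. by rewrite /form mulmxDr mulmxDl mxE. Qed.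

Lemma formZm a M X Y : form (a *: M) X Y = a * form M X Y.
Proof. by rewrite /form -scalemxAr -scalemxAl mxE. Qed.

Lemma row_basis X : X = \sum_i X 0 i *: basisv K i.
Proof. exact: row_sum_delta. Qed.

Lemma basisvE (i j : 'I_n) : basisv K i 0 j = (j == i)%:R.
Proof. by rewrite mxE. Qed.

End Forms.

Lemma sum_basis (K : fieldType) n (i : 'I_n) (F : 'I_n -> K) :
  \sum_j basisv K i 0 j * F j = F i.
Proof.
rewrite (bigD1 i) //= basisvE eqxx mul1r big1 ?addr0 // => j ji.
by rewrite basisvE (negPf ji) mul0r.
Qed.

Lemma sum_basis_scale (K : fieldType) n (V : lmodType K) (i : 'I_n)
  (F : 'I_n -> V) : \sum_j basisv K i 0 j *: F j = F i.
Proof.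
rewrite (bigD1 i) //= basisvE eqxx scale1r big1 ?addr0 // => j ji.
by rewrite basisvE (negPf ji) scale0r.
Qed.

Section Multilinear.
Variables (K : fieldType) (n : nat).
Implicit Types (T : tensor4 K n).

Lemma linear_ext (phi psi : 'rV[K]_n -> K) :
  (forall a X Y, phi (a *: X + Y) = a * phi X + phi Y) ->
  (forall a X Y, psi (a *: X + Y) = a * psi X + psi Y) ->
  (forall i, phi (basisv K i) = psi (basisv K i)) -> phi =1 psi.
Proof.
move=> Lphi Lpsi E X.
have H (chi : 'rV[K]_n -> K) : (forall a X Y, chi (a *: X + Y) = a * chi X + chi Y) ->
    chi X = \sum_i X 0 i * chi (basisv K i).
  move=> L; have chi0 : chi 0 = 0.
    by have := L (-1) 0 0; rewrite scaleN1r oppr0 addr0 mulN1r addNr.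
  rewrite [X in chi X]row_basis.
  elim/big_rec2 : _ => [//|i x y _ <-]; exact: L.
by rewrite H // [RHS]H //; apply: eq_bigr => i _; rewrite E.
Qed.

Lemma multilinear4_ext T T' : multilinear4 T -> multilinear4 T' ->
  (forall i j k l, T (basisv K i) (basisv K j) (basisv K k) (basisv K l)
                 = T' (basisv K i) (basisv K j) (basisv K k) (basisv K l)) ->
  forall X1 X2 X3 X4, T X1 X2 X3 X4 = T' X1 X2 X3 X4.
Proof.
move=> LT LT' E X1 X2 X3 X4.
move: X1; apply: linear_ext => [a X Y|a X Y|i].
- by have [] := LT a X Y X X2 X3 X4.
- by have [] := LT' a X Y X X2 X3 X4.
move: X2; apply: linear_ext => [a X Y|a X Y|j].
- by have [] := LT a X Y (basisv K i) X X3 X4.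
- by have [] := LT' a X Y (basisv K i) X X3 X4.
move: X3; apply: linear_ext => [a X Y|a X Y|k].
- by have [] := LT a X Y (basisv K i) (basisv K j) X X4.
- by have [] := LT' a X Y (basisv K i) (basisv K j) X X4.
move: X4; apply: linear_ext => [a X Y|a X Y|l].
- by have [] := LT a X Y (basisv K i) (basisv K j) (basisv K k) X.
- by have [] := LT' a X Y (basisv K i) (basisv K j) (basisv K k) X.
exact: E.
Qed.

End Multilinear.

(** * Symmetry of second derivatives *)

Section MixedPartials.
Variables (R : realType) (V : normedModType R).
Implicit Types (f g : V -> R) (a p v w : V).

Lemma is_derive_line g p v (s : R) : differentiable g (p + s *: v) ->
  is_derive s 1 (fun t : R => g (p + t *: v)) ('D_v g (p + s *: v)).
Proof.
move=> dg.
have dl : is_diff s (fun t : R => p + t *: v) (fun t : R => t *: v).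
  by apply: is_diff_eq; rewrite add0r.
have dgl : differentiable (g \o (fun t : R => p + t *: v)) s.
  by apply: differentiable_comp; first exact: ex_diff.
split; first exact: diff_derivable.
rewrite deriveE // diff_comp /=; [|exact: ex_diff|by []].
by rewrite diff_val /= scale1r deriveE.
Qed.

Lemma mvt_line g p v (h : R) : 0 < h ->
  (forall s, 0 <= s <= h -> differentiable g (p + s *: v)) ->
  exists2 s, 0 <= s <= h & g (p + h *: v) - g p = h * 'D_v g (p + s *: v).
Proof.
move=> h0 dg.
have [s|s|s /itvP sI E] := @MVT R (fun t => g (p + t *: v))
    (fun t => 'D_v g (p + t *: v)) 0 h h0.
- by rewrite in_itv /= => /andP[/ltW s0 /ltW sh]; apply/is_derive_line/dg/andP.
- apply: derivable_within_continuous s => s.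
  rewrite in_itv /= => sI; have := is_derive_line (dg _ sI).
  by move=> /@ex_derive.
- exists s; first by rewrite !sI.
  by move: E; rewrite scale0r addr0 subr0 mulrC.
Qed.

(** Two mean value steps: one along [v] for the increment [p |-> f (p + h *: w) - f p], then one
    along [w] for ['D_v f]. *)
Lemma second_difference f a v w (h : R) : 0 < h ->
  (forall s t, 0 <= s <= h -> 0 <= t <= h ->
     differentiable f (a + s *: v + t *: w) /\
     differentiable ('D_v f) (a + s *: v + t *: w)) ->
  exists s t, [/\ 0 <= s <= h, 0 <= t <= h &
    f (a + h *: v + h *: w) - f (a + h *: w) - (f (a + h *: v) - f a)
    = h ^+ 2 * 'D_w ('D_v f) (a + s *: v + t *: w)].
Proof.
move=> h0 df.
have hI : 0 <= h <= h by apply/andP; split; [exact: ltW|exact: lexx].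
have zI : 0 <= (0 : R) <= h by apply/andP; split; [exact: lexx|exact: ltW].
have dfw s : 0 <= s <= h ->
    differentiable (fun p => f (p + h *: w)) (a + s *: v).
  move=> sI; apply: (@differentiable_comp _ _ _ _ (fun p => p + h *: w) f).
    exact: ex_diff.
  by have [] := df s h sI hI.
have df0 s : 0 <= s <= h -> differentiable f (a + s *: v).
  by move=> sI; have [] := df s 0 sI zI; rewrite scale0r addr0.
have [s sI E1] := @mvt_line (fun p => f (p + h *: w) - f p) a v h h0
  (fun s sI => differentiableB (dfw s sI) (df0 s sI)).
have [t tI E2] := @mvt_line ('D_v f) (a + s *: v) w h h0
  (fun t tI => (df s t sI tI).2).
exists s, t; split=> //.
transitivity (f (a + h *: v + h *: w) - f (a + h *: v) - (f (a + h *: w) - f a)).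
  by ring.
rewrite E1 expr2 -mulrA -E2; congr (_ * _).
rewrite (@deriveB _ _ _ (fun p => f (p + h *: w)) f);
  [|exact/diff_derivable/dfw|exact/diff_derivable/df0].
congr (_ - _).
have dfs : differentiable f (a + s *: v + h *: w) by have [] := df s h sI hI.
rewrite deriveE; last exact: dfw.
rewrite (@diff_comp _ _ _ _ (fun p => p + h *: w) f);
  [|exact: ex_diff|by []].
rewrite /= diff_val /= addr0 deriveE //.
Qed.

(* Both mixed derivatives at nearby points equal the same second difference
   divided by [h ^+ 2]. *)
Lemma derive_comm f a v w :
  (\forall p \near a, differentiable f p) ->
  (\forall p \near a, differentiable ('D_v f) p) ->
  (\forall p \near a, differentiable ('D_w f) p) ->
  {for a, continuous ('D_w ('D_v f))} -> {for a, continuous ('D_v ('D_w f))} ->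
  'D_w ('D_v f) a = 'D_v ('D_w f) a.
Proof.
move=> df dvf dwf cwv cvw; apply/eqP; rewrite -subr_eq0 -normr_le0.
apply/ler_addgt0Pr => e e0; rewrite add0r.
have e2 : 0 < e / 2 by rewrite divr_gt0.
have /cvgrPdist_lt/(_ _ e2) nwv := cwv.
have /cvgrPdist_lt/(_ _ e2) nvw := cvw.
have : \forall p \near a, differentiable f p /\ differentiable ('D_v f) p /\
   differentiable ('D_w f) p /\
   `|'D_w ('D_v f) a - 'D_w ('D_v f) p| < e / 2 /\
   `|'D_v ('D_w f) a - 'D_v ('D_w f) p| < e / 2.
  exact: (filterI df (filterI dvf (filterI dwf (filterI nwv nvw)))).
move=> /nbhs_ballP[r /= r0 rP].
(* This [h] keeps the parallelogram spanned by [h *: v] and [h *: w] at [a] inside the ball of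
   radius [r]; the [1] keeps the denominator positive when both vectors vanish. *)
pose h := r / (`|v| + `|w| + 1).
have d0 : 0 < `|v| + `|w| + 1 by rewrite ltr_wpDl // addr_ge0.
have h0 : 0 < h by rewrite divr_gt0.
have inr s t : 0 <= s <= h -> 0 <= t <= h -> ball a r (a + s *: v + t *: w).
  move=> /andP[s0 sh] /andP[t0 th]; rewrite -ball_normE /ball_ /=.
  rewrite -addrA opprD addrA subrr add0r normrN.
  apply: (le_lt_trans (ler_normD _ _)); rewrite !normrZ !ger0_norm //.
  apply: (@le_lt_trans _ _ (h * (`|v| + `|w|))).
    by rewrite mulrDr lerD // ler_wpM2r.
  by rewrite /h mulrAC ltr_pdivrMr // ltr_pM2l // ltrDl.
have inr' s t : 0 <= s <= h -> 0 <= t <= h -> ball a r (a + t *: w + s *: v).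
  by move=> sI tI; rewrite addrAC; apply: inr.
have [|s [t [sI tI E1]]] := @second_difference f a v w h h0.
  by move=> s t sI tI; have [? []] := rP _ (inr _ _ sI tI).
have [|t' [s' [tI' sI' E2]]] := @second_difference f a w v h h0.
  by move=> t' s' tI' sI'; have [? [_ []]] := rP _ (inr' _ _ sI' tI').
have E : 'D_w ('D_v f) (a + s *: v + t *: w)
       = 'D_v ('D_w f) (a + t' *: w + s' *: v).
  have hh : h ^+ 2 != 0 by rewrite expf_neq0 // gt_eqF.
  apply: (mulfI hh); rewrite -E1 -E2 (addrAC a (h *: w)); ring.
have [_ [_ [_ [B1 _]]]] := rP _ (inr _ _ sI tI).
have [_ [_ [_ [_ B2]]]] := rP _ (inr' _ _ sI' tI').
rewrite -(subrKA ('D_w ('D_v f) (a + s *: v + t *: w))).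
apply: (le_trans (ler_normD _ _)); rewrite (splitr e); apply: lerD.
  exact: (ltW B1).
by rewrite E distrC; exact: (ltW B2).
Qed.

End MixedPartials.

(** * Locality of differentiability, and calculus of [smooth_on] functions *)

Section Smooth.
Variable R : realType.

Lemma near_eq_differentiable (V W : normedModType R) (f g : V -> W) (a : V) :
  (\near a, f a = g a) -> differentiable f a -> differentiable g a.
Proof.
move=> fg [[dfc /eqaddoP dfE]]; apply/diffP.
(* The differential is obtained by a choice operator, so exhibiting one linear map with the required
   property is enough; ['d f a] serves for [g]. *)
apply: (@getPex _ (fun (df : {linear V -> W}) => continuous df /\
  forall y, g y = g (lim (nbhs a)) + df (y - lim (nbhs a))
                  +o_(y \near a) (y - lim (nbhs a)))).
exists ('d f a); split=> //.
suff E : g = cst (g (lim (nbhs a))) + 'd f a \o center (lim (nbhs a))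
       +o_a (center (lim (nbhs a))) by move=> y; rewrite {1}E.
apply/eqaddoP => e e0.
have := dfE e e0; rewrite lim_id // => dE.
have E0 := nbhs_singleton fg.
apply: filterS (filterI fg dE) => y [Ey].
rewrite -[(f - _) y]/(f y - _) -[(g - _) y]/(g y - _) /=.
by rewrite -Ey -E0.
Qed.

Section SmoothOn.
Variables (n : nat) (W : normedModType R) (U : set 'rV[R]_n).
Implicit Types f g : 'rV[R]_n -> W.

Lemma smooth_on_differentiable f u :
  smooth_on U f -> U u -> differentiable f u.
Proof. by move=> sf Uu; exact: (sf [::] u Uu). Qed.

Lemma smooth_on_partial f i : smooth_on U f -> smooth_on U (partial i f).
Proof. by move=> sf s u Uu; have := sf (rcons s i) u Uu; rewrite foldr_rcons. Qed.

Lemma smooth_on_derivable f u v : smooth_on U f -> U u -> derivable f u v.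
Proof. by move=> sf Uu; apply/diff_derivable/(smooth_on_differentiable sf). Qed.

End SmoothOn.

Lemma smooth_on_sub n (W : normedModType R) (U U' : set 'rV[R]_n)
  (f : 'rV[R]_n -> W) : U' `<=` U -> smooth_on U f -> smooth_on U' f.
Proof. by move=> sU sf s u /sU Uu; exact: sf. Qed.

Section MatrixValued.
Variables (n p q : nat) (U : set 'rV[R]_n) (f : 'rV[R]_n -> 'M[R]_(p, q)).
Hypotheses (oU : open U) (sf : smooth_on U f).

Lemma partial_entry i a b u :
  U u -> partial i (fun v => f v a b) u = partial i f u a b.
Proof.
by move=> Uu; rewrite /partial derive_mx ?mxE //; exact: smooth_on_derivable sf Uu.
Qed.

Lemma differentiable_entry a b (g : 'rV[R]_n -> 'M[R]_(p, q)) u :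
  differentiable g u -> differentiable (fun v => g v a b) u.
Proof.
move=> dg; apply: (@differentiable_comp _ _ _ _ g (fun N => N a b)) => //.
exact: differentiable_coord.
Qed.

(** [derive_comm] is scalar. Near [u] the partial derivatives of an entry are the entries of the
    partial derivatives, so its hypotheses carry over from the matrix to each entry. *)
Lemma partialC i j u : U u ->
  partial i (partial j f) u = partial j (partial i f) u.
Proof.
move=> Uu; apply/matrixP => a b.
have nU : \forall v \near u, U v by exact: open_nbhs_nbhs.
have nE k : \forall v \near u,
    partial k f v a b = partial k (fun w => f w a b) v.
  by apply: filterS nU => v Uv; rewrite partial_entry.
have dE k l : partial l (partial k f) u a b
    = partial l (partial k (fun w => f w a b)) u.
  rewrite /partial derive_mx ?mxE; last first.
    exact: smooth_on_derivable (smooth_on_partial k sf) Uu.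
  exact: near_eq_derive (nE k).
have dd k : \forall v \near u,
    differentiable (partial k (fun w => f w a b)) v.
  apply: filterS nU => v Uv.
  apply: (@near_eq_differentiable _ _ (fun w => partial k f w a b)).
    by apply: filterS (open_nbhs_nbhs (conj oU Uv)) => w Uw;
      exact/esym/partial_entry.
  apply: differentiable_entry; apply: smooth_on_differentiable Uv.
  exact: smooth_on_partial.
have cc k l : {for u, continuous (partial l (partial k (fun w => f w a b)))}.
  have nE' : \forall v \near u, partial l (partial k f) v a b
      = partial l (partial k (fun w => f w a b)) v.
    apply: filterS nU => v Uv.
    rewrite /partial derive_mx ?mxE; last first.
      exact: smooth_on_derivable (smooth_on_partial k sf) Uv.
    apply: near_eq_derive.
    by apply: filterS (open_nbhs_nbhs (conj oU Uv)) => w Uw;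
      exact/esym/partial_entry.
  apply: differentiable_continuous.
  apply: (@near_eq_differentiable _ _ (fun w => partial l (partial k f) w a b)).
    by [].
  apply: differentiable_entry; apply: smooth_on_differentiable Uu.
  exact/smooth_on_partial/smooth_on_partial.
refine (etrans (dE j i) (etrans _ (esym (dE i j)))).
refine (@derive_comm _ _ _ _ _ _ _ (dd j) (dd i) (cc j i) (cc i j)).
by apply: filterS nU => v Uv; exact/differentiable_entry/(smooth_on_differentiable sf).
Qed.

End MatrixValued.

End Smooth.

(** * Derivatives of metrics along maps *)

Section ProductRules.
Variables (R : realType) (V : normedModType R) (m : nat).

Lemma derive_entry p q (A : V -> 'M[R]_(p, q)) v w i j : derivable A v w ->
  'D_w (fun x => A x i j) v = 'D_w A v i j.
Proof. by move=> dA; rewrite (derive_mx dA) mxE. Qed.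

Lemma is_derive_entry p q (A : V -> 'M[R]_(p, q)) v w i j :
  derivable A v w -> is_derive v w (fun x => A x i j) ('D_w A v i j).
Proof.
move=> dA; split; last exact: derive_entry.
exact: (proj1 (derivable_mxP _ _ _) dA i j).
Qed.

Lemma is_derive_form (M : V -> 'M[R]_m) (A B : V -> 'rV[R]_m) v w :
  derivable M v w -> derivable A v w -> derivable B v w ->
  is_derive v w (fun x => form (M x) (A x) (B x))
    (form ('D_w M v) (A v) (B v) + form (M v) ('D_w A v) (B v)
     + form (M v) (A v) ('D_w B v)).
Proof.
move=> dM dA dB.
have -> : (fun x => form (M x) (A x) (B x))
    = \sum_i \sum_j (fun x => A x 0 i * M x i j * B x 0 j).
  apply/funext => x; rewrite formE fct_sumE; apply: eq_bigr => i _.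
  by rewrite fct_sumE.
pose t i j := 'D_w M v i j * (A v 0 i * B v 0 j)
  + 'D_w A v 0 i * (M v i j * B v 0 j) + A v 0 i * M v i j * 'D_w B v 0 j.
have -> : form ('D_w M v) (A v) (B v) + form (M v) ('D_w A v) (B v)
     + form (M v) (A v) ('D_w B v) = \sum_i \sum_j t i j.
  rewrite !formE -!big_split; apply: eq_bigr => i _.
  by rewrite -!big_split; apply: eq_bigr => j _; rewrite /t /=; ring.
apply: is_derive_sum => i; apply: is_derive_sum => j.
have dMe : is_derive v w (fun x => M x i j) ('D_w M v i j).
  exact: is_derive_entry.
have dAe : is_derive v w (fun x => A x 0 i) ('D_w A v 0 i).
  exact: is_derive_entry.
have dBe : is_derive v w (fun x => B x 0 j) ('D_w B v 0 j).
  exact: is_derive_entry.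
have := is_deriveM (is_deriveM dAe dMe) dBe.
move=> d; apply: is_derive_eq d _; rewrite /t !fctE /GRing.scale /=; ring.
Qed.

Lemma is_derive_Zmx p q (a : V -> R) (M : V -> 'M[R]_(p, q)) v w :
  derivable a v w -> derivable M v w ->
  is_derive v w (fun x => a x *: M x) ('D_w a v *: M v + a v *: 'D_w M v).
Proof.
move=> da dM.
have de i j : is_derive v w (fun x => (a x *: M x) i j)
    (('D_w a v *: M v + a v *: 'D_w M v) i j).
  have -> : (fun x => (a x *: M x) i j) = (fun x => a x * M x i j).
    by apply/funext => x; rewrite mxE.
  have dMe : is_derive v w (fun x => M x i j) ('D_w M v i j).
    exact: is_derive_entry.
  have := is_deriveM (derivableP da) dMe.
  by move=> d; apply: is_derive_eq d _; rewrite !mxE /GRing.scale /=; ring.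
have dd : derivable (fun x => a x *: M x) v w.
  by apply/derivable_mxP => i j; have := de i j; move=> /@ex_derive.
split=> //; rewrite derive_mx //; apply/matrixP => i j.
by rewrite mxE; have := de i j; move=> /@derive_val.
Qed.

End ProductRules.

Section ChainRule.
Variables (R : realType) (m p q : nat).
Implicit Types (M : 'rV[R]_m -> 'M[R]_(p, q)).

Definition dmx M (u W : 'rV[R]_m) : 'M[R]_(p, q) :=
  \sum_c W 0 c *: partial c M u.

(* The second derivative of [M] in the directions [W], [W']. *)
Definition d2mx M (u W W' : 'rV[R]_m) : 'M[R]_(p, q) :=
  \sum_c W' 0 c *: dmx (partial c M) u W.

Lemma dmx_is_linear M u : linear (dmx M u).
Proof.
move=> a X Y; rewrite /dmx scaler_sumr -big_split; apply: eq_bigr => c _.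
by rewrite !mxE scalerDl scalerA.
Qed.

Lemma d2mx_linearl M u W' : linear (d2mx M u ^~ W').
Proof.
move=> a X Y; rewrite /d2mx scaler_sumr -big_split; apply: eq_bigr => c _.
by rewrite dmx_is_linear scalerDr !scalerA mulrC.
Qed.

Lemma d2mx_linearr M u W : linear (d2mx M u W).
Proof.
move=> a X Y; rewrite /d2mx scaler_sumr -big_split; apply: eq_bigr => c _.
by rewrite !mxE scalerDl scalerA.
Qed.

Lemma deriveEdmx M u w : differentiable M u -> 'D_w M u = dmx M u w.
Proof.
move=> dM; rewrite deriveE // [X in 'd M u X]row_basis linear_sum.
by apply: eq_bigr => c _; rewrite linearZ /= /partial deriveE.
Qed.

Lemma derive_comp_mx n (F : 'rV[R]_n -> 'rV[R]_m) M u w :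
  differentiable F u -> differentiable M (F u) ->
  'D_w (M \o F) u = dmx M (F u) ('D_w F u).
Proof.
move=> dF dM; rewrite (deriveE w (differentiable_comp dF dM)).
rewrite (deriveE w dF) -(deriveEdmx ('d F u w) dM) (deriveE _ dM).
by rewrite (diff_comp dF dM).
Qed.

(** With [G] a partial derivative of [F], this is the second-order chain rule for [M \o F]. *)
Lemma is_derive_dmx_comp n (F G : 'rV[R]_n -> 'rV[R]_m) M u w :
  differentiable F u -> derivable G u w ->
  (forall c, differentiable (partial c M) (F u)) ->
  is_derive u w (fun v => dmx M (F v) (G v))
    (dmx M (F u) ('D_w G u) + d2mx M (F u) ('D_w F u) (G u)).
Proof.
move=> dF dG dM.
have -> : (fun v => dmx M (F v) (G v))
    = \sum_c (fun v => G v 0 c *: (partial c M \o F) v).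
  by apply/funext => v; rewrite fct_sumE.
rewrite /dmx /d2mx -big_split; apply: is_derive_sum => c.
have dGc : derivable (fun v => G v 0 c) u w.
  exact: (proj1 (derivable_mxP _ _ _) dG 0 c).
have dMc : derivable (partial c M \o F) u w.
  by apply/diff_derivable/differentiable_comp.
apply: (is_derive_eq (is_derive_Zmx dGc dMc)).
by congr (_ *: _ + _ *: _); [exact: derive_entry | exact: derive_comp_mx].
Qed.

End ChainRule.

(** * The lowered curvature tensor of a metric *)

(* [lra] and [ring] compare their atoms up to conversion, which is intractable
   when the atoms are derivatives. *)
Ltac generalize_forms := repeat match goal with
  | |- context [form ?M ?X ?Y] => generalize (form M X Y); intro
  end.

(** * Derivability of determinants and inverse matrices *)

Section Derivability.
Variables (R : realType) (V : normedModType R).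

Lemma derivable_bigsum (I : finType) (h : I -> V -> R) v w :
  (forall i, derivable (h i) v w) -> derivable (fun x => \sum_i h i x) v w.
Proof.
move=> dh; have -> : (fun x => \sum_i h i x) = \sum_i h i.
  by apply/funext => x; rewrite fct_sumE.
elim/big_ind : _ => [|f g df dg|i _]; last exact: dh.
  exact: derivable_cst.
exact: derivableD.
Qed.

Lemma derivable_bigprod (I : finType) (h : I -> V -> R) v w :
  (forall i, derivable (h i) v w) -> derivable (fun x => \prod_i h i x) v w.
Proof.
move=> dh; elim: (index_enum I) => [|i s IHs].
  have -> : (fun x => \prod_(i <- [::]) h i x) = cst 1.
    by apply/funext => x; rewrite big_nil.
  exact: derivable_cst.
have -> : (fun x => \prod_(i <- i :: s) h i x)
    = h i * (fun x => \prod_(i <- s) h i x).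
  by apply/funext => x; rewrite big_cons.
by apply: derivableM; first exact: dh.
Qed.

Lemma derivable_det n (M : V -> 'M[R]_n) v w :
  (forall i j, derivable (fun x => M x i j) v w) ->
  derivable (fun x => \det (M x)) v w.
Proof.
move=> dM; rewrite /determinant; apply: derivable_bigsum => s.
apply: (@derivableM _ _ (cst _)); first exact: derivable_cst.
by apply: derivable_bigprod => i; exact: dM.
Qed.

(** Cramer's rule: where [M] is invertible, an entry of the inverse is a cofactor divided by the
    determinant. *)
Lemma derivable_invmx n (M : V -> 'M[R]_n) v w i j :
  (\forall x \near v, M x \in unitmx) -> derivable M v w ->
  derivable (fun x => invmx (M x) i j) v w.
Proof.
move=> uM /derivable_mxP dM.
apply: (@near_eq_derivable _ _ _
  (fun x => (\det (M x))^-1 * ((-1) ^+ (j + i) * \det (row' j (col' i (M x)))))).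
  apply: filterS uM => x ux.
  by rewrite /invmx ux !mxE.
have ud : \det (M v) != 0.
  by have := nbhs_singleton uM; rewrite unitmxE unitfE.
apply: (@derivableM _ _ (fun x => (\det (M x))^-1)).
  by apply: derivableV => //; exact: derivable_det.
apply: (@derivableM _ _ (cst _)); first exact: derivable_cst.
apply: derivable_det => k l.
have -> : (fun x => row' j (col' i (M x)) k l)
    = (fun x => M x (lift j k) (lift i l)).
  by apply/funext => x; rewrite !mxE.
exact: dM.
Qed.

End Derivability.

Section LinearSums.
Variables (K : fieldType) (n : nat) (V : lmodType K).

Lemma linear_coord_sum (F : 'I_n -> V) :
  linear (fun X : 'rV[K]_n => \sum_i X 0 i *: F i).
Proof.
move=> a X Y; rewrite scaler_sumr -big_split; apply: eq_bigr => i _.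
by rewrite !mxE scalerDl scalerA.
Qed.

End LinearSums.

Section LoweredRiemann.
Opaque derive.
Variables (R : realType) (n : nat) (U : set 'rV[R]_n) (G : 'rV[R]_n -> 'M[R]_n).
Hypotheses (oU : open U) (sG : smooth_on U G).
Hypotheses (symG : forall u, U u -> (G u)^T = G u).
Hypotheses (unitG : forall u, U u -> G u \in unitmx).
Implicit Types (u X Y Z : 'rV[R]_n).

Let e := @basisv R n.

(* Christoffel symbols of the first kind, and below those of the second kind, as
   functions of vectors. *)
Definition christoffel_first u X Y Z : R := 2^-1 *
  (form (dmx G u X) Y Z + form (dmx G u Y) X Z - form (dmx G u Z) X Y).

Definition christoffel_vec u X Y : 'rV[R]_n :=
  \sum_i X 0 i *: \sum_j Y 0 j *: \row_k christoffel G i j k u.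

Lemma chr_linearl u Y : linear (christoffel_vec u ^~ Y).
Proof. exact: linear_coord_sum. Qed.

Lemma chr_linearr u X : linear (christoffel_vec u X).
Proof.
move=> a Y Y'; rewrite /christoffel_vec scaler_sumr -big_split; apply: eq_bigr => i _.
by rewrite linear_coord_sum scalerDr !scalerA mulrC.
Qed.

Lemma chr_basis u i j : christoffel_vec u (e i) (e j) = \row_k christoffel G i j k u.
Proof. by rewrite /christoffel_vec sum_basis_scale sum_basis_scale. Qed.

Lemma dmetricE i j k u : U u -> dmetric G i j k u = partial i G u j k.
Proof. by move=> Uu; rewrite /dmetric (partial_entry sG). Qed.

Lemma dmx_basis (M : 'rV[R]_n -> 'M[R]_n) u i : dmx M u (e i) = partial i M u.
Proof. by rewrite /dmx sum_basis_scale. Qed.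

Lemma d2mx_basis (M : 'rV[R]_n -> 'M[R]_n) u i j :
  d2mx M u (e i) (e j) = partial i (partial j M) u.
Proof. by rewrite /d2mx sum_basis_scale dmx_basis. Qed.

Lemma sym_partial i u : U u -> (partial i G u)^T = partial i G u.
Proof.
move=> Uu; apply/matrixP => a b; rewrite mxE -!(partial_entry sG) //.
apply: near_eq_derive.
by apply: filterS (open_nbhs_nbhs (conj oU Uu)) => v Uv; rewrite -[in LHS]symG // mxE.
Qed.

Lemma sym_dmx u X : U u -> (dmx G u X)^T = dmx G u X.
Proof.
move=> Uu; rewrite /dmx linear_sum; apply: eq_bigr => c _.
by rewrite linearZ /= sym_partial.
Qed.

Lemma chr1_basis u i j k : U u -> christoffel_first u (e i) (e j) (e k)
  = 2^-1 * (dmetric G i j k u + dmetric G j i k u - dmetric G k i j u).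
Proof.
move=> Uu; rewrite (dmetricE i j k Uu) (dmetricE j i k Uu) (dmetricE k i j Uu).
rewrite /christoffel_first (dmx_basis G u i) (dmx_basis G u j) (dmx_basis G u k).
by congr (_ * (_ + _ - _)); exact: form_basis.
Qed.

(** Lowering the index cancels the inverse metric in [christoffel], leaving the Koszul expression in
    the first derivatives of [G]. *)
Lemma chrP u X Y Z : U u ->
  form (G u) (christoffel_vec u X Y) Z = christoffel_first u X Y Z.
Proof.
move=> Uu; rewrite /christoffel_first.
move: X; apply: linear_ext => [a X X'|a X X'|i].
- by rewrite chr_linearl formDl formZl.
- by rewrite dmx_is_linear formDm formZm !formDl !formZl; ring.
move: Y; apply: linear_ext => [a Y Y'|a Y Y'|j].
- by rewrite chr_linearr formDl formZl.
- by rewrite dmx_is_linear formDm formZm !formDl !formZl !formDr !formZr; ring.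
move: Z; apply: linear_ext => [a Z Z'|a Z Z'|k].
- by rewrite formDr formZr.
- by rewrite dmx_is_linear formDm formZm !formDr !formZr; ring.
rewrite -/(christoffel_first u (e i) (e j) (e k)) -/(e i) -/(e j) -/(e k).
rewrite chr_basis chr1_basis //.
pose t := \row_l (2^-1 * (dmetric G i j l u + dmetric G j i l u - dmetric G l i j u)).
have -> : \row_l christoffel G i j l u = t *m invmx (G u).
  apply/rowP => l; rewrite !mxE /christoffel mulr_sumr; apply: eq_bigr => m _.
  rewrite mxE; have -> : invmx (G u) m l = invmx (G u) l m.
    by rewrite -[in LHS](symG Uu) -trmx_inv mxE.
  ring.
by rewrite /form mulmxKV ?unitG // trmx_delta -colE !mxE.
Qed.

Lemma chrC u X Y : U u -> christoffel_vec u X Y = christoffel_vec u Y X.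
Proof.
move=> Uu.
have E : christoffel_vec u X Y *m G u = christoffel_vec u Y X *m G u.
  apply/rowP => k.
  have E : form (G u) (christoffel_vec u X Y) (e k)
      = form (G u) (christoffel_vec u Y X) (e k).
    rewrite !chrP // /christoffel_first (form_sym X Y (sym_dmx _ Uu)); ring.
  by move: E; rewrite /form trmx_delta -!colE !mxE.
by rewrite -[LHS](mulmxK (unitG Uu)) E mulmxK // unitG.
Qed.

Lemma derivable_christoffel i j k u w : U u ->
  derivable (christoffel G i j k) u w.
Proof.
move=> Uu; have nU := open_nbhs_nbhs (conj oU Uu).
have dd a b c : derivable (dmetric G a b c) u w.
  apply: (@near_eq_derivable _ _ _ (fun v => partial a G v b c)).
    by apply: filterS nU => v Uv; rewrite dmetricE.
  have dG : derivable (partial a G) u w.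
    exact: smooth_on_derivable (smooth_on_partial a sG) Uu.
  exact: (proj1 (derivable_mxP _ _ _) dG b c).
apply: (@derivableM _ _ (cst _)); first exact: derivable_cst.
apply: derivable_bigsum => l; apply: derivableM.
  apply: derivable_invmx; first by apply: filterS nU => v; exact: unitG.
  exact: smooth_on_derivable sG Uu.
by apply: derivableB => //; apply: derivableD.
Qed.

Lemma derive_chr i j k u : U u ->
  is_derive u (e i) (fun v => christoffel_vec v (e j) (e k))
    (\row_l partial i (christoffel G j k l) u).
Proof.
move=> Uu.
have -> : (fun v => christoffel_vec v (e j) (e k))
    = (fun v => \row_l christoffel G j k l v).
  by apply/funext => v; rewrite chr_basis.
have de l : (fun v => (\row_l christoffel G j k l v) 0 l) = christoffel G j k l.
  by apply/funext => v; rewrite mxE.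
have dd : derivable (fun v => \row_l christoffel G j k l v) u (e i).
  by apply/derivable_mxP => a l; rewrite (ord1 a) de; exact: derivable_christoffel.
split=> //; rewrite (derive_mx dd); apply/matrixP => a l.
by rewrite (ord1 a) !mxE de.
Qed.

(* Differentiating [g(Gamma(e_j, e_k), e_l)] avoids derivatives of [invmx G]. *)
Lemma partial_chr1 i j k l u : U u ->
  form (G u) (\row_m partial i (christoffel G j k m) u) (e l)
  + form (partial i G u) (christoffel_vec u (e j) (e k)) (e l)
  = 2^-1 * (form (d2mx G u (e i) (e j)) (e k) (e l)
            + form (d2mx G u (e i) (e k)) (e j) (e l)
            - form (d2mx G u (e i) (e l)) (e j) (e k)).
Proof.
move=> Uu; have nU := open_nbhs_nbhs (conj oU Uu).
have d1 := is_derive_form (smooth_on_derivable (v := e i) sG Uu)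
  (@ex_derive _ _ _ _ _ _ _ (derive_chr i j k Uu)) (derivable_cst (e l) u (e i)).
have d2 a b c : is_derive u (e i) (fun v => partial a G v b c)
    (form (d2mx G u (e i) (e a)) (e b) (e c)).
  rewrite d2mx_basis form_basis; apply: is_derive_entry.
  exact: smooth_on_derivable (smooth_on_partial a sG) Uu.
have d3 := is_deriveZ 2^-1
  (is_deriveB (is_deriveD (d2 j k l) (d2 k j l)) (d2 l j k)).
have E : \forall v \near u, form (G v) (christoffel_vec v (e j) (e k)) (e l)
    = 2^-1 * (partial j G v k l + partial k G v j l - partial l G v j k).
  apply: filterS nU => v Uv; rewrite chrP // chr1_basis //.
  by rewrite (dmetricE j k l Uv) (dmetricE k j l Uv) (dmetricE l j k Uv).
have := near_eq_derive (e i) E.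
rewrite (@derive_val _ _ _ _ _ _ _ d1) (@derive_val _ _ _ _ _ _ _ d3).
rewrite (@derive_val _ _ _ _ _ _ _ (derive_chr i j k Uu)) derive_cst.
rewrite /GRing.scale /= => <-.
by rewrite addrC [X in _ = _ + X](_ : _ = 0) ?addr0 // /form trmx0 !mulmx0 mxE.
Qed.

(** The classical formula for the fully covariant curvature tensor. Second derivatives of the metric
    enter linearly and no Christoffel symbol is differentiated, which makes it comparable between
    [g] and the ambient metric. *)
Definition riemann_first u X1 X2 X3 X4 : R :=
  2^-1 * (form (d2mx G u X1 X3) X2 X4 - form (d2mx G u X1 X4) X2 X3
          - form (d2mx G u X2 X3) X1 X4 + form (d2mx G u X2 X4) X1 X3)
  - form (G u) (christoffel_vec u X2 X3) (christoffel_vec u X1 X4)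
  + form (G u) (christoffel_vec u X1 X3) (christoffel_vec u X2 X4).

Lemma riemann_first_multilinear u : multilinear4 (riemann_first u).
Proof.
move=> a X Y X1 X2 X3 X4; rewrite /riemann_first; split;
  rewrite ?(chr_linearl, chr_linearr, d2mx_linearl, d2mx_linearr);
  rewrite !(formDm, formZm, formDl, formDr, formZl, formZr); ring.
Qed.

Lemma riemann_at_multilinear u : multilinear4 (riemann_at G u).
Proof.
have E X1 X2 X3 X4 : riemann_at G u X1 X2 X3 X4 =
    form (G u) (\sum_i X1 0 i *: \sum_j X2 0 j *: \sum_k X3 0 k *:
      \row_l riemann_coef G i j k l u) X4.
  congr form; apply/rowP => l; rewrite !mxE summxE; apply: eq_bigr => i _.
  rewrite !mxE summxE mulr_sumr; apply: eq_bigr => j _.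
  rewrite !mxE summxE !mulr_sumr; apply: eq_bigr => k _.
  by rewrite !mxE; ring.
move=> a X Y X1 X2 X3 X4; split; rewrite !E.
- by rewrite linear_coord_sum formDl formZl.
- rewrite -formZl -formDl scaler_sumr -big_split; congr form; apply: eq_bigr => i _.
  by rewrite linear_coord_sum scalerDr !scalerA mulrC.
- rewrite -formZl -formDl scaler_sumr -big_split; congr form; apply: eq_bigr => i _.
  rewrite /= scalerA (mulrC a) -scalerA -scalerDr; congr (_ *: _).
  rewrite scaler_sumr -big_split; apply: eq_bigr => j _.
  by rewrite linear_coord_sum scalerDr !scalerA mulrC.
- by rewrite formDr formZr.
Qed.

Lemma chr_chr u i j k l : christoffel_vec u (e i) (christoffel_vec u (e j) (e k)) 0 l
  = \sum_m christoffel G j k m u * christoffel G i m l u.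
Proof.
rewrite {1}/christoffel_vec sum_basis_scale summxE; apply: eq_bigr => m _.
by rewrite chr_basis !mxE.
Qed.

Opaque dmx d2mx christoffel_vec.

Lemma riemann_atE u X1 X2 X3 X4 : U u ->
  riemann_at G u X1 X2 X3 X4 = riemann_first u X1 X2 X3 X4.
Proof.
move=> Uu; move: X1 X2 X3 X4.
apply: multilinear4_ext;
  [exact: riemann_at_multilinear|exact: riemann_first_multilinear|].
move=> i j k l; rewrite -/(e i) -/(e j) -/(e k) -/(e l).
pose D i j k := \row_m partial i (christoffel G j k m) u.
have -> : riemann_at G u (e i) (e j) (e k) (e l) = form (G u)
    (D i j k - D j i k + christoffel_vec u (e i) (christoffel_vec u (e j) (e k))
     - christoffel_vec u (e j) (christoffel_vec u (e i) (e k))) (e l).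
  congr form; apply/rowP => m; rewrite !mxE.
  under eq_bigr => a _.
    under eq_bigr => b _.
      under eq_bigr => c _ do rewrite -mulrA -mulrA.
      rewrite -mulr_sumr -mulr_sumr sum_basis; over.
    rewrite -mulr_sumr sum_basis; over.
  rewrite sum_basis /riemann_coef -addrA; congr (_ + _).
  by rewrite !chr_chr sumrB.
have sd X := sym_dmx X Uu.
(* Compatibility of the Levi-Civita connection with the metric. *)
have dE a Y Z : form (partial a G u) Y Z = form (G u) (christoffel_vec u (e a) Y) Z
    + form (G u) (christoffel_vec u (e a) Z) Y.
  rewrite (chrP _ _ _ Uu) (chrP _ _ _ Uu) -dmx_basis /christoffel_first -/(e a).
  rewrite (form_sym Z Y (sd _)).
  by field.
(* Compatibility splits the term of [partial_chr1] that contains [partial a G] in two: one half is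
   the quadratic term of the curvature, the other is a product of Christoffel vectors that stays in
   [riemann_first]. *)
have H a b : form (G u) (D a b k) (e l)
    + (form (G u) (christoffel_vec u (e a) (christoffel_vec u (e b) (e k))) (e l)
       + form (G u) (christoffel_vec u (e a) (e l)) (christoffel_vec u (e b) (e k)))
    = 2^-1 * (form (d2mx G u (e a) (e b)) (e k) (e l)
            + form (d2mx G u (e a) (e k)) (e b) (e l)
            - form (d2mx G u (e a) (e l)) (e b) (e k)).
  by rewrite -dE; exact: partial_chr1.
have H1 := H i j; have H2 := H j i.
(* Symmetry of second derivatives removes the term in [d_i d_j g_kl], the only one without a
   counterpart in [riemann_first]. *)
have S : d2mx G u (e i) (e j) = d2mx G u (e j) (e i).
  by rewrite (d2mx_basis G u i j) (d2mx_basis G u j i); exact: (partialC oU sG).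
rewrite !(formDl, formNl).
rewrite S in H1.
rewrite /riemann_first.
rewrite (form_sym (christoffel_vec u (e j) (e k))
  (christoffel_vec u (e i) (e l)) (symG Uu)).
rewrite (form_sym (christoffel_vec u (e i) (e k))
  (christoffel_vec u (e j) (e l)) (symG Uu)).
move: H1 H2; generalize_forms => H1 H2; clear -H1 H2; lra.
Qed.

End LoweredRiemann.

(** * The Gauss equation *)

Section NormalComplement.
Variables (K : fieldType) (n : nat).
Variables (J : 'M[K]_(n, n.+1)) (Q : 'M[K]_n.+1) (x : 'rV[K]_n.+1) (eps : K).
Hypotheses (eps2 : eps * eps = 1) (symQ : Q^T = Q) (unitQ : Q \in unitmx).
Hypothesis unitG : J *m Q *m J^T \in unitmx.
Hypotheses (xJ : x *m Q *m J^T = 0) (xx : form Q x x = eps).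

(** The inverse ambient metric is the sum of its tangential and normal parts: multiplied by [Q], the
    right-hand side fixes the rows of [J] and the vector [x], which together form a basis. *)
Lemma invmx_normal_complement :
  invmx Q = J^T *m invmx (J *m Q *m J^T) *m J + eps *: (x^T *m x).
Proof.
set G := J *m Q *m J^T; set L := RHS.
have xQx : x *m Q *m x^T = eps%:M.
  by rewrite [LHS]mx11_scalar -xx.
have Jx : J *m Q *m x^T = 0.
  by apply: trmx_inj; rewrite trmx0 !trmx_mul trmxK symQ mulmxA.
pose B := row_mx J^T x^T : 'M[K]_(n.+1, (n + 1)%N).
have LQE k (Z : 'M[K]_(n.+1, k)) : L *m Q *m Z
    = J^T *m (invmx G *m (J *m Q *m Z)) + eps *: (x^T *m (x *m Q *m Z)).
  by rewrite /L !mulmxDl -!scalemxAl !mulmxA.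
have LQB : L *m Q *m B = B.
  rewrite /B mul_mx_row !LQE xJ xQx Jx -/G mulVmx // !mulmx0 scaler0 addr0.
  by rewrite mulmx1 add0r mul_mx_scalar scalerA eps2 scale1r.
(* An explicit left inverse [A] of [B], dual to this basis, forces full rank. *)
have Bfree : row_free B.
  pose A := col_mx (invmx G *m (J *m Q)) (eps *: (x *m Q)) : 'M[K]_((n + 1)%N, n.+1).
  have AB : A *m B = 1%:M.
    rewrite /A /B mul_col_row -!scalemxAl xJ xQx -!(mulmxA (invmx G)).
    by rewrite Jx -/G mulVmx // mulmx0 scaler0 scale_scalar_mx eps2 -scalar_mx_block.
  rewrite /row_free eqn_leq rank_leq_row /=.
  by apply: leq_trans (mxrankM_maxr A B); rewrite AB mxrank1 addn1.
have LQ : L *m Q = 1%:M.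
  apply/eqP; rewrite -subr_eq0 -(mulmx_free_eq0 _ Bfree).
  by rewrite mulmxBl LQB mul1mx subrr.
by rewrite -[LHS]mul1mx -LQ mulmxK.
Qed.

(** The two assumptions say that [a] and [b] are the coordinates of the orthogonal projections of
    [X] and [Y] to the tangent space, so this is Pythagoras; [eps] stands for its own inverse. *)
Lemma form_normal_complement (a b : 'rV[K]_n) (X Y : 'rV[K]_n.+1) :
  a *m (J *m Q *m J^T) = X *m Q *m J^T ->
  b *m (J *m Q *m J^T) = Y *m Q *m J^T ->
  form (J *m Q *m J^T) a b = form Q X Y - eps * form Q X x * form Q Y x.
Proof.
set G := J *m Q *m J^T => aE bE.
have symG : G^T = G by rewrite /G !trmx_mul trmxK symQ mulmxA.
have E : a *m G *m b^T = X *m Q *m (J^T *m invmx G *m J) *m Q *m Y^T.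
  rewrite aE -!mulmxA; congr (_ *m (_ *m (_ *m _))).
  have -> : J *m (Q *m Y^T) = G *m b^T.
    by apply: trmx_inj; rewrite [RHS]trmx_mul trmxK symG bE !trmx_mul trmxK symQ.
  by rewrite mulKmx.
have {}E : a *m G *m b^T = X *m Q *m Y^T - eps *: ((X *m Q *m x^T) *m (x *m Q *m Y^T)).
  rewrite E; have -> : J^T *m invmx G *m J = invmx Q - eps *: (x^T *m x).
    by rewrite invmx_normal_complement addrK.
  by rewrite mulmxBr mulmxK // !mulmxBl -scalemxAr -!scalemxAl !mulmxA.
rewrite (form_sym Y x symQ) {1}/form E mxE; congr (_ + _).
by rewrite mxE mxE mxE big_ord1 mulrA.
Qed.

End NormalComplement.

(* The algebra behind the Gauss equation, with the 2-jet of the metrics and the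
   3-jet of the immersion as abstract data: [j1], [j2], [j3] stand for the
   derivatives of the immersion, [dq] and [d2q] for those of the ambient metric
   [q], [c] for its connection, [g1], [g2], [gc] for the first and second
   derivatives and the squared connection of the induced metric, and [h] for
   the second fundamental form. *)
Section GaussAlgebra.
Variables (K : numFieldType) (V : zmodType) (I : Type).
Variables (q : V -> V -> K) (dq : V -> V -> V -> K) (d2q : V -> V -> V -> V -> K).
Variables (j1 : I -> V) (j2 : I -> I -> V) (j3 : I -> I -> I -> V).
Variables (c : I -> I -> V) (h : I -> I -> K) (eps : K).
Variables (g1 : I -> I -> I -> K) (g2 gc : I -> I -> I -> I -> K).
Hypotheses (symq : forall X Y, q X Y = q Y X).
Hypotheses (symdq : forall Z X Y, dq Z X Y = dq Z Y X).
Hypotheses (qD : forall X Y Z, q (X + Y) Z = q X Z + q Y Z).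
Hypotheses (j2C : forall i j, j2 i j = j2 j i).
Hypotheses (j3Cl : forall i j k, j3 i j k = j3 j i k).
Hypotheses (j3Cr : forall i j k, j3 i j k = j3 i k j).
Hypothesis qc : forall i j Z, q (c i j) Z = 2^-1 *
  (dq (j1 i) (j1 j) Z + dq (j1 j) (j1 i) Z - dq Z (j1 i) (j1 j)).

(** In the Koszul combination of [g1] the second derivatives of the immersion cancel in pairs,
    except for [q (j2 i j) (j1 k)]. *)
Lemma tangential_algebra i j k :
  (forall i j k, g1 i j k = dq (j1 i) (j1 j) (j1 k)
    + q (j2 i j) (j1 k) + q (j1 j) (j2 i k)) ->
  2^-1 * (g1 i j k + g1 j i k - g1 k i j) = q (j2 i j + c i j) (j1 k).
Proof.
move=> g1E; rewrite !g1E qD qc (j2C k i) (j2C k j) (j2C j i).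
by rewrite (symq (j1 j) (j2 i k)) (symq (j1 i) (j2 j k)); field.
Qed.

(** The alternating sum kills the third derivatives [j3] by symmetry. The terms [q j2 j2] and the
    mixed terms in [dq] and [j2] cancel against those of the squared accelerations in [gc], by [qc];
    what is left is the ambient curvature and the products of [h]. *)
Lemma gauss_algebra i j k l :
  (forall a i j k, g2 a i j k = d2q (j1 a) (j1 i) (j1 j) (j1 k)
    + dq (j2 a i) (j1 j) (j1 k) + dq (j1 i) (j2 a j) (j1 k)
    + dq (j1 i) (j1 j) (j2 a k) + dq (j1 a) (j2 i j) (j1 k)
    + q (j3 a i j) (j1 k) + q (j2 i j) (j2 a k) + dq (j1 a) (j1 j) (j2 i k)
    + q (j2 a j) (j2 i k) + q (j1 j) (j3 a i k)) ->
  (forall i j k l, gc i j k l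
    = q (j2 i j + c i j) (j2 k l + c k l) - eps * h i j * h k l) ->
  2^-1 * (g2 i k j l - g2 i l j k - g2 j k i l + g2 j l i k)
    - gc j k i l + gc i k j l
  = 2^-1 * (d2q (j1 i) (j1 k) (j1 j) (j1 l) - d2q (j1 i) (j1 l) (j1 j) (j1 k)
            - d2q (j1 j) (j1 k) (j1 i) (j1 l) + d2q (j1 j) (j1 l) (j1 i) (j1 k))
    - q (c j k) (c i l) + q (c i k) (c j l)
    + eps * (h i l * h j k - h i k * h j l).
Proof.
move=> g2E gcE; rewrite !g2E !gcE.
have accE a b a' b' : q (j2 a b + c a b) (j2 a' b' + c a' b')
    = q (j2 a b) (j2 a' b') + q (c a b) (j2 a' b') + q (c a' b') (j2 a b)
      + q (c a b) (c a' b').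
  rewrite qD !(symq _ (j2 a' b' + _)) !qD !(symq (c a' b')) (symq (j2 a' b')).
  by rewrite (symq (j2 a' b') (c a b)); ring.
rewrite !accE !(qc _ _ (j2 _ _)).
rewrite (j3Cr i k j) (j3Cr i l j) (j3Cr i l k).
rewrite (j3Cr j k i) (j3Cr j l i) (j3Cr j l k) (j3Cl j i k) (j3Cl j i l).
rewrite (j2C l i) (j2C l j) (j2C l k) (j2C k i) (j2C k j) (j2C j i).
rewrite (symq (j2 j l) (j2 i k)) (symq (j2 i l) (j2 j k)).
have sd Z a b d : dq Z (j1 a) (j2 b d) = dq Z (j2 b d) (j1 a) by exact: symdq.
have sT a b d e : q (j1 a) (j3 b d e) = q (j3 b d e) (j1 a) by exact: symq.
by rewrite !sd !sT; field.
Qed.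

End GaussAlgebra.

(** * The Gauss equation in one pair of charts *)

Section Gauss.
Variables (R : realType) (n : nat).
Variables (U : set 'rV[R]_n) (U' : set 'rV[R]_n.+1).
Variables (F : 'rV[R]_n -> 'rV[R]_n.+1).
Variables (G : 'rV[R]_n -> 'M[R]_n) (Q : 'rV[R]_n.+1 -> 'M[R]_n.+1).
Hypotheses (oU : open U) (oU' : open U').
Hypotheses (sF : smooth_on U F) (FU : forall v, U v -> U' (F v)).
Hypotheses (sG : smooth_on U G) (symG : forall v, U v -> (G v)^T = G v).
Hypotheses (unitG : forall v, U v -> G v \in unitmx).
Hypotheses (sQ : smooth_on U' Q) (symQ : forall v, U' v -> (Q v)^T = Q v).
Hypotheses (unitQ : forall v, U' v -> Q v \in unitmx).
Hypothesis GE : forall v, U v -> G v = 'J F v *m Q (F v) *m ('J F v)^T.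
Variables (u : 'rV[R]_n) (xi : 'rV[R]_n.+1) (eps : R).
Hypotheses (Uu : U u) (eps2 : eps * eps = 1).
Hypotheses (xiF : xi *m Q (F u) *m ('J F u)^T = 0) (xi1 : form (Q (F u)) xi xi = eps).

Let e := @basisv R n.
Let D i := partial i F.
Let DD i j := partial i (partial j F).

Opaque derive.

Lemma row_jacobian i v : U v -> row i ('J F v) = D i v.
Proof.
move=> Uv; have dF := smooth_on_differentiable sF Uv.
by rewrite rowE mul_rV_lin1 /D /partial deriveE.
Qed.

Lemma induced_metricE i j v : U v -> G v i j = form (Q (F v)) (D i v) (D j v).
Proof.
move=> Uv; rewrite -!row_jacobian // /form.
by rewrite GE // !rowE trmx_mul trmx_delta !mulmxA -colE -!mulmxA -rowE !mxE.
Qed.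

Lemma partial_induced_metric i j k v : U v ->
  partial i G v j k = form (dmx Q (F v) (D i v)) (D j v) (D k v)
    + form (Q (F v)) (DD i j v) (D k v) + form (Q (F v)) (D j v) (DD i k v).
Proof.
move=> Uv; rewrite -(partial_entry sG i j k Uv).
have nU := open_nbhs_nbhs (conj oU Uv).
have dF := smooth_on_differentiable sF Uv.
have dQ := smooth_on_differentiable sQ (FU Uv).
have dD a : derivable (D a) v (e i).
  exact: smooth_on_derivable (smooth_on_partial a sF) Uv.
have dQF : derivable (Q \o F) v (e i).
  by apply: diff_derivable; exact: differentiable_comp dF dQ.
have E : \forall w \near v,
   G w j k = form ((Q \o F) w) (D j w) (D k w).
  by apply: filterS nU => w Uw; rewrite induced_metricE.
have H := is_derive_form dQF (dD j) (dD k).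
have := near_eq_derive (e i) E.
rewrite (@derive_val _ _ _ _ _ _ _ H) (derive_comp_mx (e i) dF dQ).
exact.
Qed.

Lemma partial2_induced_metric a i j k :
  partial a (partial i G) u j k =
    form (d2mx Q (F u) (D a u) (D i u)) (D j u) (D k u)
  + form (dmx Q (F u) (DD a i u)) (D j u) (D k u)
  + form (dmx Q (F u) (D i u)) (DD a j u) (D k u)
  + form (dmx Q (F u) (D i u)) (D j u) (DD a k u)
  + form (dmx Q (F u) (D a u)) (DD i j u) (D k u)
  + form (Q (F u)) (partial a (DD i j) u) (D k u)
  + form (Q (F u)) (DD i j u) (DD a k u)
  + form (dmx Q (F u) (D a u)) (D j u) (DD i k u)
  + form (Q (F u)) (DD a j u) (DD i k u)
  + form (Q (F u)) (D j u) (partial a (DD i k) u).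
Proof.
have nU := open_nbhs_nbhs (conj oU Uu).
rewrite -(partial_entry (smooth_on_partial i sG) a j k Uu).
have dF := smooth_on_differentiable sF Uu.
have dQ := smooth_on_differentiable sQ (FU Uu).
have dD b : derivable (D b) u (e a).
  exact: smooth_on_derivable (smooth_on_partial b sF) Uu.
have dDD b c : derivable (DD b c) u (e a).
  exact: smooth_on_derivable (smooth_on_partial b (smooth_on_partial c sF)) Uu.
have dQF : derivable (Q \o F) u (e a).
  by apply: diff_derivable; exact: differentiable_comp dF dQ.
have dpQ c : differentiable (partial c Q) (F u).
  exact: smooth_on_differentiable (smooth_on_partial c sQ) (FU Uu).
have ddQ := is_derive_dmx_comp dF (dD i) dpQ.
have H0 := is_derive_form (@ex_derive _ _ _ _ _ _ _ ddQ) (dD j) (dD k).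
have H1 := is_derive_form dQF (dDD i j) (dD k).
have H2 := is_derive_form dQF (dD j) (dDD i k).
have H := is_deriveD (is_deriveD H0 H1) H2.
have E : \forall w \near u, partial i G w j k =
    form (dmx Q (F w) (D i w)) (D j w) (D k w)
    + form ((Q \o F) w) (DD i j w) (D k w) + form ((Q \o F) w) (D j w) (DD i k w).
  by apply: filterS nU => w Uw; rewrite partial_induced_metric.
have := near_eq_derive (e a) E.
rewrite (@derive_val _ _ _ _ _ _ _ H) (@derive_val _ _ _ _ _ _ _ ddQ).
rewrite (derive_comp_mx (e a) dF dQ) => d2.
(* The same equality up to conversion, stated in the terms of the goal so that [generalize_forms]
   gives equal values one name. *)
have {}d2 : partial a (fun v => partial i G v j k) u =
    form (dmx Q (F u) (DD a i u) + d2mx Q (F u) (D a u) (D i u)) (D j u) (D k u)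
    + form (dmx Q (F u) (D i u)) (DD a j u) (D k u)
    + form (dmx Q (F u) (D i u)) (D j u) (DD a k u)
    + (form (dmx Q (F u) (D a u)) (DD i j u) (D k u)
       + form (Q (F u)) (partial a (DD i j) u) (D k u)
       + form (Q (F u)) (DD i j u) (DD a k u))
    + (form (dmx Q (F u) (D a u)) (D j u) (DD i k u)
       + form (Q (F u)) (DD a j u) (DD i k u)
       + form (Q (F u)) (D j u) (partial a (DD i k) u)) by exact: d2.
rewrite d2 formDm; generalize_forms; ring.
Qed.

Definition jet1 i := partial i F u.
Definition jet2 i j := partial i (partial j F) u.
Definition jet3 i j k := partial i (partial j (partial k F)) u.

Lemma jet2C i j : jet2 i j = jet2 j i.
Proof. exact: (partialC oU sF). Qed.

Lemma jet3Cl i j k : jet3 i j k = jet3 j i k.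
Proof. exact: (partialC oU (smooth_on_partial k sF)). Qed.

Lemma jet3Cr i j k : jet3 i j k = jet3 i k j.
Proof.
apply: near_eq_derive; apply: filterS (open_nbhs_nbhs (conj oU Uu)) => v Uv.
exact: (partialC oU sF).
Qed.

(** The ambient covariant derivative of [F_* e_j] along [e_i]. *)
Definition acceleration i j := jet2 i j + christoffel_vec Q (F u) (jet1 i) (jet1 j).

Definition second_form_mx := \matrix_(i, j) form (Q (F u)) (acceleration i j) xi.

Let FUu : U' (F u) := FU Uu.
Let symq X Y : form (Q (F u)) X Y = form (Q (F u)) Y X.
Proof. exact: form_sym (symQ FUu). Qed.
Let symdq Z X Y : form (dmx Q (F u) Z) X Y = form (dmx Q (F u) Z) Y X.
Proof. exact/form_sym/(sym_dmx oU' sQ symQ). Qed.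
Let chrQ i j Z : form (Q (F u)) (christoffel_vec Q (F u) (jet1 i) (jet1 j)) Z
  = christoffel_first Q (F u) (jet1 i) (jet1 j) Z.
Proof. exact: (chrP sQ symQ unitQ _ _ _ FUu). Qed.

(** The tangential part of the Gauss formula: the induced connection is the projection of the
    ambient one. *)
Lemma christoffel_tangential i j k :
  form (G u) (christoffel_vec G u (e i) (e j)) (e k)
  = form (Q (F u)) (acceleration i j) (jet1 k).
Proof.
refine (etrans (chrP sG symG unitG _ _ _ Uu) _).
refine (etrans (chr1_basis sG i j k Uu) _).
refine (@tangential_algebra R _ _ (form (Q (F u))) (fun Z => form (dmx Q (F u) Z))
  jet1 jet2 (fun i j => christoffel_vec Q (F u) (jet1 i) (jet1 j))
  (fun i j k => dmetric G i j k u) symq (formDl _) jet2C chrQ i j k _).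
by move=> a b d; refine (etrans (dmetricE sG a b d Uu) _); exact: partial_induced_metric.
Qed.

(** By [christoffel_tangential] the Christoffel vectors are projected accelerations, so
    [form_normal_complement] applies. This is where the second fundamental form enters the
    curvature. *)
Lemma form_christoffel i j k l :
  form (G u) (christoffel_vec G u (e i) (e j)) (christoffel_vec G u (e k) (e l))
  = form (Q (F u)) (acceleration i j) (acceleration k l)
    - eps * second_form_mx i j * second_form_mx k l.
Proof.
rewrite ![second_form_mx _ _]mxE.
have H a b : christoffel_vec G u (e a) (e b) *m ('J F u *m Q (F u) *m ('J F u)^T)
    = acceleration a b *m Q (F u) *m ('J F u)^T.
  rewrite -(GE Uu); apply/rowP => c.
  refine (etrans (esym (form_basisr _ _ c)) _).
  refine (etrans (christoffel_tangential a b c) _).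
  by refine (etrans _ (form_row _ _ _ c)); rewrite row_jacobian.
rewrite (GE Uu).
apply: (form_normal_complement eps2 _ _ _ xiF xi1 (H i j) (H k l)).
- exact: symQ.
- exact: unitQ.
- by rewrite -(GE Uu); exact: unitG.
Qed.

Lemma gauss_basis i j k l :
  riemann_first G u (e i) (e j) (e k) (e l)
  = riemann_first Q (F u) (jet1 i) (jet1 j) (jet1 k) (jet1 l)
    + eps * (second_form_mx i l * second_form_mx j k
             - second_form_mx i k * second_form_mx j l).
Proof.
refine (@gauss_algebra R _ _ (form (Q (F u))) (fun Z => form (dmx Q (F u) Z))
  (fun Z W => form (d2mx Q (F u) Z W))
  jet1 jet2 jet3 (fun i j => christoffel_vec Q (F u) (jet1 i) (jet1 j))
  (fun i j => second_form_mx i j) eps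
  (fun a i j k => form (d2mx G u (e a) (e i)) (e j) (e k))
  (fun i j k l => form (G u) (christoffel_vec G u (e i) (e j))
     (christoffel_vec G u (e k) (e l)))
  symq symdq (formDl _) jet2C jet3Cl jet3Cr chrQ i j k l _ form_christoffel).
move=> a b c d; rewrite (d2mx_basis G u a b); refine (etrans (form_basis _ c d) _).
exact: partial2_induced_metric.
Qed.

Lemma gauss_equation X1 X2 X3 X4 : let h := form second_form_mx in
  riemann_at G u X1 X2 X3 X4
  = riemann_at Q (F u) (X1 *m 'J F u) (X2 *m 'J F u) (X3 *m 'J F u) (X4 *m 'J F u)
    + eps * (h X1 X4 * h X2 X3 - h X1 X3 * h X2 X4).
Proof.
move=> h; rewrite (riemann_atE oU sG symG unitG) //.
rewrite (riemann_atE oU' sQ symQ unitQ) //.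
move: X1 X2 X3 X4; apply: multilinear4_ext.
- exact: riemann_first_multilinear.
- move=> a X Y X1 X2 X3 X4; rewrite /h !mulmxDl -!scalemxAl.
  rewrite !(formDl, formDr, formZl, formZr).
  have [-> -> -> ->] := riemann_first_multilinear Q (F u) a (X *m 'J F u)
    (Y *m 'J F u) (X1 *m 'J F u) (X2 *m 'J F u) (X3 *m 'J F u) (X4 *m 'J F u).
  by split; ring.
move=> i j k l; rewrite gauss_basis /h !form_basis.
by rewrite -!rowE !row_jacobian.
Qed.

Lemma second_form_mx_sym : second_form_mx^T = second_form_mx.
Proof.
apply/matrixP => i j; rewrite !mxE.
have E : acceleration j i = acceleration i j.
  exact: (f_equal2 +%R (jet2C j i) (chrC oU' sQ symQ unitQ _ _ FUu)).
exact: (congr1 (fun v => form (Q (F u)) v xi) E).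
Qed.

End Gauss.

Lemma kn_self (K : fieldType) n (A : tensor2 K n) X1 X2 X3 X4 :
  kn A A X1 X2 X3 X4 = 2 * (A X1 X4 * A X2 X3 - A X1 X3 * A X2 X4).
Proof. rewrite /kn; ring. Qed.

(** * The Gauss equation on manifolds, in the charts at [x] and [f x] *)

Section HypersurfaceGauss.
Variables (R : realType) (n : nat) (M : manifold R n) (N : manifold R n.+1).
Variables (g : metric M) (gN : metric N) (f : M -> N).
Variables (isof : isometric_immersion g gN f) (eps : R) (eps2 : eps * eps = 1).
Variables (xi : M -> 'rV[R]_n.+1) (xiN : unit_normal gN f xi eps).

Lemma open_local_dom x : open (local_dom f x (f x)).
Proof.
rewrite openE => v [cv dv]; apply: filterI.
  by apply: open_nbhs_nbhs; split; [exact: ccod_open|].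
have cf : {for v, continuous (f \o cinv (chart_at x))}.
  by apply: continuous_comp; [exact: cinv_cont|exact: (isof.1)].
by apply: cf; apply: open_nbhs_nbhs; split; [exact: cdom_open|].
Qed.

Lemma local_dom_coord x : local_dom f x (f x) (coord x).
Proof.
split; first exact/cmap_in/chart_at_dom.
by rewrite /coord cmapK; exact: chart_at_dom.
Qed.

Lemma local_rep_coord x : local_rep f x (f x) (coord x) = coord (f x).
Proof. by rewrite /local_rep /coord /= cmapK //; exact: chart_at_dom. Qed.

Lemma gauss_hypersurface (c : R) (ccN : constant_curvature gN c) x :
  exists2 h : 'M[R]_n, h^T = h &
    second_fundamental gN f xi x = form h /\
    forall X1 X2 X3 X4, curvature g x X1 X2 X3 X4
      = c / 2 * kn (metric_at g x) (metric_at g x) X1 X2 X3 X4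
        + eps / 2 * kn (form h) (form h) X1 X2 X3 X4.
Proof.
pose U := local_dom f x (f x); pose U' := ccod (chart_at (f x)).
pose F := local_rep f x (f x); pose u := coord x.
pose G := mcomp g x; pose Q := mcomp gN (f x).
have oU : open U by exact: open_local_dom.
have Uu : U u by exact: local_dom_coord.
have Fu : F u = coord (f x) by exact: local_rep_coord.
have oU' : open U' by exact: ccod_open.
have sF : smooth_on U F by have [] := isof.2 x (f x).
have FU v : U v -> U' (F v) by case=> cv dv; exact: cmap_in.
have sG : smooth_on U G.
  by apply: (smooth_on_sub _ (mcomp_smooth g (x := x))) => v [].
have symG v : U v -> (G v)^T = G v by case=> cv _; exact: mcomp_sym.
have unitG v : U v -> G v \in unitmx by case=> cv _; exact: mcomp_unit.
have sQ : smooth_on U' Q by exact: mcomp_smooth.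
have symQ v : U' v -> (Q v)^T = Q v by exact: mcomp_sym.
have unitQ v : U' v -> Q v \in unitmx by exact: mcomp_unit.
have GE v : U v -> G v = 'J F v *m Q (F v) *m ('J F v)^T.
  by move=> Uv; have [_] := isof.2 x (f x); exact.
have [xiF0 xi10] := xiN x.
have xi1 : form (Q (F u)) (xi x) (xi x) = eps by rewrite Fu.
have xiF : xi x *m Q (F u) *m ('J F u)^T = 0.
  apply/rowP => i; rewrite -form_row rowE mxE Fu.
  exact: xiF0.
have G1 := gauss_equation oU oU' sF FU sG symG unitG sQ symQ unitQ GE Uu eps2 xiF xi1.
exists (second_form_mx F Q u (xi x)).
  exact: (second_form_mx_sym oU oU' sF FU sQ symQ unitQ (xi x) Uu).
have J4 i j : ambient_derivative gN f x i j = acceleration F Q u i j.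
  apply/rowP => a; rewrite /ambient_derivative /acceleration !mxE.
  congr (_ + _); rewrite /christoffel_vec summxE; apply: eq_bigr => b _.
  rewrite !mxE summxE mulr_sumr; apply: eq_bigr => k _.
  by rewrite !mxE /jet1 -/F -/u; ring.
split.
  apply/funext => X; apply/funext => Y; rewrite formE /second_fundamental.
  apply: eq_bigr => i _; apply: eq_bigr => j _.
  rewrite mxE J4 /metric_at -Fu -/Q; ring.
move=> X1 X2 X3 X4; rewrite /curvature G1 !kn_self.
have -> : riemann_at Q (F u) (X1 *m 'J F u) (X2 *m 'J F u) (X3 *m 'J F u) (X4 *m 'J F u)
   = c * (form (G u) X1 X4 * form (G u) X2 X3 - form (G u) X1 X3 * form (G u) X2 X4).
  have := ccN (f x) (X1 *m 'J F u) (X2 *m 'J F u) (X3 *m 'J F u) (X4 *m 'J F u).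
  rewrite /curvature -/Q -Fu => ->; rewrite kn_self.
  have Fe X Y : metric_at gN (f x) (X *m 'J F u) (Y *m 'J F u) = form (G u) X Y.
    by rewrite /metric_at -/Q -Fu /form (GE _ Uu) trmx_mul !mulmxA.
  by rewrite !Fe; field.
by rewrite /metric_at -/G -/u; field.
Qed.

End HypersurfaceGauss.

(** * Contractions and Weyl tensors *)

Section Contraction.
Variables (K : fieldType) (n : nat) (G : 'M[K]_n).
Hypotheses (symG : G^T = G) (unitG : G \in unitmx).
Let g : tensor2 K n := form G.
Implicit Types (X Y Z W : 'rV[K]_n) (A B : tensor2 K n) (phi : 'rV[K]_n -> K).

Definition linear_form phi := forall a X Y, phi (a *: X + Y) = a * phi X + phi Y.

(** The metric trace without [sharp]: [tr2] and [ricci] both reduce to it by [trace_sharp], and it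
    is visibly linear in [B]. *)
Definition ctr B : K :=
  \sum_i \sum_j invmx G i j * B (basisv K i) (basisv K j).

Lemma gram_form : gram g = G.
Proof. by apply/matrixP => i j; rewrite mxE /g form_basis. Qed.

Lemma sharpP phi Y : linear_form phi -> g (sharp g phi) Y = phi Y.
Proof.
move=> Lphi; move: Y; apply: linear_ext => // [a Y Y'|j].
  by rewrite /g formDr formZr.
by rewrite /g form_basisr /sharp gram_form mulmxKV // mxE.
Qed.

Lemma sharp_unique phi Z : (forall Y, g Z Y = phi Y) -> sharp g phi = Z.
Proof.
move=> E; rewrite /sharp gram_form.
have -> : \row_j phi (basisv K j) = Z *m G.
  by apply/rowP => j; rewrite mxE -E /g form_basisr.
by rewrite mulmxK.
Qed.

Lemma trace_sharp (T : 'rV[K]_n -> 'rV[K]_n -> K) :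
  trace (fun Z => sharp g (T Z)) = ctr T.
Proof.
rewrite /trace /mxtrace; apply: eq_bigr => i _.
rewrite mxE /sharp gram_form mxE; apply: eq_bigr => j _.
have -> : invmx G i j = invmx G j i by rewrite -[in RHS]symG -trmx_inv mxE.
by rewrite mxE mulrC.
Qed.

Lemma ricci_ctr T X Y : ricci g T X Y = ctr (fun Z W => T Z X Y W).
Proof. exact: trace_sharp. Qed.

Lemma tr2_ctr A : tr2 g A = ctr A.
Proof. exact: trace_sharp. Qed.

Lemma ctrD A B : ctr (fun Z W => A Z W + B Z W) = ctr A + ctr B.
Proof.
rewrite /ctr -big_split; apply: eq_bigr => i _; rewrite -big_split.
by apply: eq_bigr => j _; rewrite mulrDr.
Qed.

Lemma ctrZ a A : ctr (fun Z W => a * A Z W) = a * ctr A.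
Proof.
rewrite /ctr mulr_sumr; apply: eq_bigr => i _; rewrite mulr_sumr.
by apply: eq_bigr => j _; rewrite mulrCA.
Qed.

Lemma ctrN A : ctr (fun Z W => - A Z W) = - ctr A.
Proof. by rewrite -mulN1r -ctrZ; congr ctr; do 2!apply/funext=> ?; rewrite mulN1r. Qed.

Lemma ctrB A B : ctr (fun Z W => A Z W - B Z W) = ctr A - ctr B.
Proof. by rewrite ctrD ctrN. Qed.

Lemma ctr_swap B : ctr (fun Z W => B W Z) = ctr B.
Proof.
rewrite /ctr exchange_big; apply: eq_bigr => i _; apply: eq_bigr => j _.
by rewrite -[in LHS]symG -trmx_inv mxE.
Qed.

(** The inverse matrix cancels the metric, so contraction against [g X] is substitution of [X]. Most
    later traces are computed this way. *)
Lemma ctr_metric phi X : linear_form phi -> ctr (fun Z W => g X Z * phi W) = phi X.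
Proof.
move=> Lphi; move: X; apply: linear_ext => // [a X Y|k].
  rewrite -ctrZ -ctrD; congr ctr; do 2!apply/funext=> ?.
  by rewrite /g formDl formZl mulrDl mulrA.
transitivity (\sum_j (G *m invmx G) k j * phi (basisv K j)).
  rewrite /ctr exchange_big; apply: eq_bigr => j _; rewrite mxE mulr_suml.
  by apply: eq_bigr => i _; rewrite /g form_basis mulrCA mulrA.
rewrite mulmxV // -(sum_basis k (fun j => phi (basisv K j))).
by apply: eq_bigr => j _; rewrite mxE basisvE eq_sym.
Qed.

Lemma ctr_metric_swap phi X :
  linear_form phi -> ctr (fun Z W => g X W * phi Z) = phi X.
Proof.
by move=> Lphi; rewrite (ctr_swap (fun W Z => g X W * phi Z)) ctr_metric.
Qed.

Lemma ctr_self : ctr g = n%:R.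
Proof.
transitivity (\sum_i (invmx G *m G) i i).
  apply: eq_bigr => i _; rewrite mxE; apply: eq_bigr => j _.
  by rewrite /g form_basis; congr (_ * _); rewrite -[in LHS]symG mxE.
rewrite mulVmx // (eq_bigr (fun=> 1)) => [|i _]; last by rewrite mxE eqxx.
by rewrite sumr_const card_ord.
Qed.

Lemma metric_inj X X' : (forall Y, g X Y = g X' Y) -> X = X'.
Proof.
move=> E; have EG : X *m G = X' *m G.
  by apply/rowP => i; rewrite -!form_basisr; exact: E.
by rewrite -(mulmxK unitG X) EG mulmxK.
Qed.

End Contraction.

(** * Symmetric bilinear forms and generalized curvature tensors *)

Section SymmetricBilinear.
Variables (K : fieldType) (n : nat).
Implicit Types (A B : tensor2 K n) (X Y Z : 'rV[K]_n).

Definition symbil A :=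
  (forall a X Y Z, A (a *: X + Y) Z = a * A X Z + A Y Z) /\
  (forall X Y, A X Y = A Y X).

Lemma symbil_form M : M^T = M -> symbil (form M).
Proof.
by move=> sM; split=> [a X Y Z|X Y]; [rewrite formDl formZl|exact: form_sym].
Qed.

Lemma symbil_lin A B a : symbil A -> symbil B ->
  symbil (fun X Y => a * A X Y + B X Y).
Proof.
move=> [LA sA] [LB sB]; split=> [b X Y Z|X Y]; last by rewrite sA sB.
by rewrite LA LB; ring.
Qed.

Lemma symbilr A a X Y Z : symbil A -> A Z (a *: X + Y) = a * A Z X + A Z Y.
Proof. by move=> [LA sA]; rewrite sA LA !(sA Z). Qed.

Lemma symbil0 : symbil (fun _ _ => 0 : K).
Proof. by split=> *; rewrite ?mulr0 ?addr0. Qed.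

Lemma gct_kn A B : symbil A -> symbil B -> gen_curvature_tensor (kn A B).
Proof.
move=> sbA sbB; have [LA sA] := sbA; have [LB sB] := sbB; rewrite /kn; split.
- move=> a X Y X1 X2 X3 X4.
  by split; rewrite ?(LA, LB, symbilr _ _ _ _ sbA, symbilr _ _ _ _ sbB); ring.
- by move=> *; ring.
- move=> X1 X2 X3 X4.
  by rewrite (sA X3 X2) (sA X4 X1) (sA X3 X1) (sA X4 X2)
    (sB X3 X2) (sB X4 X1) (sB X3 X1) (sB X4 X2); ring.
- move=> X1 X2 X3 X4.
  by rewrite (sA X3 X2) (sB X3 X2) (sA X3 X1) (sB X3 X1) (sA X2 X1) (sB X2 X1); ring.
Qed.

Lemma gct_lin (T T' : tensor4 K n) b :
  gen_curvature_tensor T -> gen_curvature_tensor T' ->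
  gen_curvature_tensor (fun X1 X2 X3 X4 => b * T X1 X2 X3 X4 + T' X1 X2 X3 X4).
Proof.
move=> [L1 a1 p1 b1] [L2 a2 p2 b2]; split.
- move=> a X Y X1 X2 X3 X4.
  have [-> -> -> ->] := L1 a X Y X1 X2 X3 X4.
  by have [-> -> -> ->] := L2 a X Y X1 X2 X3 X4; split; ring.
- by move=> X1 X2 X3 X4; rewrite a1 a2; ring.
- by move=> X1 X2 X3 X4; rewrite p1 p2.
- move=> X1 X2 X3 X4; have := b1 X1 X2 X3 X4; have := b2 X1 X2 X3 X4.
  set u := T X1 X2 X3 X4; set v := T X2 X3 X1 X4; set w := T X3 X1 X2 X4.
  set u' := T' X1 X2 X3 X4; set v' := T' X2 X3 X1 X4; set w' := T' X3 X1 X2 X4.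
  move=> E' E; transitivity (b * (u + v + w) + (u' + v' + w')); first by ring.
  by rewrite E E' mulr0 addr0.
Qed.

Lemma gct_scale (T : tensor4 K n) b : gen_curvature_tensor T ->
  gen_curvature_tensor (fun X1 X2 X3 X4 => b * T X1 X2 X3 X4).
Proof.
move=> gT; have -> : (fun X1 X2 X3 X4 => b * T X1 X2 X3 X4)
    = (fun X1 X2 X3 X4 => (b - 1) * T X1 X2 X3 X4 + T X1 X2 X3 X4).
  by do 4!apply/funext => ?; ring.
exact: gct_lin.
Qed.

End SymmetricBilinear.

Section BilinearRules.
Variables (K : fieldType) (n : nat) (A : tensor2 K n) (sA : symbil A).
Implicit Types (X Y Z : 'rV[K]_n).

Lemma symbil0l Z : A 0 Z = 0.
Proof. by have := sA.1 (-1) 0 0 Z; rewrite scaleN1r oppr0 addr0 mulN1r addNr. Qed.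

Lemma symbilDl X Y Z : A (X + Y) Z = A X Z + A Y Z.
Proof. by rewrite -[X in A (X + _)]scale1r sA.1 mul1r. Qed.

Lemma symbilZl a X Z : A (a *: X) Z = a * A X Z.
Proof. by rewrite -[X in A X]addr0 sA.1 symbil0l addr0. Qed.

Lemma symbilNl X Z : A (- X) Z = - A X Z.
Proof. by rewrite -scaleN1r symbilZl mulN1r. Qed.

Lemma symbilDr X Y Z : A Z (X + Y) = A Z X + A Z Y.
Proof. by rewrite sA.2 symbilDl !(sA.2 Z). Qed.

Lemma symbilZr a X Z : A Z (a *: X) = a * A Z X.
Proof. by rewrite sA.2 symbilZl (sA.2 Z). Qed.

Lemma symbilNr X Z : A Z (- X) = - A Z X.
Proof. by rewrite sA.2 symbilNl (sA.2 Z). Qed.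

Definition symbilE :=
  (symbilDl, symbilNl, symbilZl, symbilDr, symbilNr, symbilZr).

Lemma linear_symbill Y : linear_form (A ^~ Y).
Proof. by move=> a X X'; rewrite sA.1. Qed.

Lemma linear_symbilr Y : linear_form (A Y).
Proof. by move=> a X X'; rewrite symbilDr symbilZr. Qed.

End BilinearRules.

Section LinearForms.
Variables (K : fieldType) (n : nat).
Implicit Types (phi psi : 'rV[K]_n -> K).

Lemma linear_form_sub phi a b X Y : linear_form phi ->
  phi (a *: X - b *: Y) = a * phi X - b * phi Y.
Proof.
move=> L; rewrite L; congr (_ + _).
have phi0 : phi 0 = 0 by have := L (-1) 0 0; rewrite scaleN1r oppr0 addr0 mulN1r addNr.
by rewrite -[- _ in LHS]addr0 -scaleNr L phi0 addr0 mulNr.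
Qed.

End LinearForms.

Lemma natrB_neq0 (K : numDomainType) m n : (m < n)%N -> n%:R - m%:R != 0 :> K.
Proof. by move=> mn; rewrite subr_eq0 eqr_nat gtn_eqF. Qed.

Section Weyl.
Variables (K : numFieldType) (n : nat) (G : 'M[K]_n).
Hypotheses (symG : G^T = G) (unitG : G \in unitmx) (n_gt2 : (2 < n)%N).
Let g : tensor2 K n := form G.
Implicit Types (X Y Z W : 'rV[K]_n) (A B : tensor2 K n) (T : tensor4 K n).

Let sg : symbil g := symbil_form symG.

Lemma endoP A X Y : symbil A -> g (endo g A X) Y = A X Y.
Proof. by move=> sA; apply: sharpP => //; exact: linear_symbilr. Qed.

Lemma ctr_symbil A phi X : symbil A -> linear_form phi ->
  ctr G (fun Z W => A X Z * phi W) = phi (endo g A X).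
Proof.
move=> sA Lphi; rewrite -(ctr_metric unitG) //; congr ctr.
by do 2!apply/funext=> ?; congr (_ * _); exact/esym/endoP.
Qed.

Lemma ctr_symbil_swap A phi X : symbil A -> linear_form phi ->
  ctr G (fun Z W => phi Z * A X W) = phi (endo g A X).
Proof.
move=> sA Lphi; rewrite -(ctr_symbil _ sA Lphi) -(ctr_swap symG); congr ctr.
by do 2!apply/funext=> ?; rewrite mulrC.
Qed.

Lemma endo_self X : endo g g X = X.
Proof. by apply: (metric_inj unitG) => Y; exact: endoP. Qed.

Lemma endo_lin A a X Y : symbil A ->
  endo g A (a *: X + Y) = a *: endo g A X + endo g A Y.
Proof.
move=> sA; apply: (metric_inj unitG) => Z; rewrite formDl formZl.
by rewrite -/g !endoP // sA.1.
Qed.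

Lemma endo_adj A B X Y : symbil A -> symbil B ->
  A (endo g B X) Y = B X (endo g A Y).
Proof. by move=> sA sB; rewrite sA.2 -(endoP Y) // sg.2 endoP. Qed.

Lemma symbil_pow2 A : symbil A -> symbil (pow2 g A).
Proof.
move=> sA; split=> [a X Y Z|X Y]; rewrite /pow2; last first.
  by rewrite endo_adj // sA.2.
by rewrite endo_lin // sA.1.
Qed.

Lemma ricci_kn A B X Y : symbil A -> symbil B ->
  ricci g (kn A B) X Y = tr2 g A * B X Y + tr2 g B * A X Y
    - A (endo g B X) Y - B (endo g A X) Y.
Proof.
move=> sA sB; rewrite ricci_ctr // !tr2_ctr //.
have -> : (fun Z W => kn A B Z X Y W) = (fun Z W =>
    B X Y * A Z W + A X Y * B Z W - B X W * A Z Y - A X W * B Z Y).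
  by do 2!apply/funext=> ?; rewrite /kn; ring.
rewrite !(ctrB, ctrD, ctrZ); congr (_ + _ - _ - _); rewrite 1?mulrC //.
  rewrite -(ctr_symbil_swap _ sB (linear_symbill sA Y)); congr ctr.
  by do 2!apply/funext=> ?; rewrite mulrC.
rewrite -(ctr_symbil_swap _ sA (linear_symbill sB Y)); congr ctr.
by do 2!apply/funext=> ?; rewrite mulrC.
Qed.

Lemma ricci_kn_metric B X Y : symbil B ->
  ricci g (kn g B) X Y = (n%:R - 2) * B X Y + tr2 g B * g X Y.
Proof.
move=> sB; rewrite ricci_kn // endo_self tr2_ctr // ctr_self // endoP //.
by ring.
Qed.

Lemma tr2_lin A B a : tr2 g (fun X Y => a * A X Y + B X Y) = a * tr2 g A + tr2 g B.
Proof. by rewrite !tr2_ctr // ctrD ctrZ. Qed.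

Lemma tr2_metric : tr2 g g = n%:R.
Proof. by rewrite tr2_ctr // ctr_self. Qed.

Lemma weyl_lin T T' a X1 X2 X3 X4 :
  weyl g (fun X1 X2 X3 X4 => a * T X1 X2 X3 X4 + T' X1 X2 X3 X4) X1 X2 X3 X4
  = a * weyl g T X1 X2 X3 X4 + weyl g T' X1 X2 X3 X4.
Proof.
have ricE : ricci g (fun X1 X2 X3 X4 => a * T X1 X2 X3 X4 + T' X1 X2 X3 X4)
    = fun X Y => a * ricci g T X Y + ricci g T' X Y.
  by do 2!apply/funext=> ?; rewrite !ricci_ctr // ctrD ctrZ.
by rewrite /weyl /scal ricE tr2_lin /kn; ring.
Qed.

Let n1 : n%:R - 1 != 0 :> K := natrB_neq0 K (ltnW n_gt2).

Let n2 : n%:R - 2 != 0 :> K := natrB_neq0 K n_gt2.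

(** [Ric(g /\ B) = (n-2) B + tr(B) g] has trace [2(n-1) tr(B)]; the coefficients of the Weyl tensor
    are those that cancel these contributions. *)
Lemma weyl_kn_metric B X1 X2 X3 X4 : symbil B -> weyl g (kn g B) X1 X2 X3 X4 = 0.
Proof.
move=> sB; have ricE : ricci g (kn g B) = fun X Y => (n%:R - 2) * B X Y + tr2 g B * g X Y.
  by do 2!apply/funext=> ?; rewrite ricci_kn_metric.
have trE : scal g (kn g B) = 2 * (n%:R - 1) * tr2 g B.
  rewrite /scal ricE (tr2_lin B (fun X Y => tr2 g B * g X Y)).
  by rewrite [tr2 g (fun _ _ => _ * _)]tr2_ctr // ctrZ ctr_self //; ring.
by rewrite /weyl trE ricE /kn; field; rewrite n1 n2.
Qed.

(** The origin of [E]: since [Ric(A /\ A) = 2 (tr(A) A - A^2)], the tensor [E] formed from [A] is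
    [(n-2)/2] times the Weyl part of [A /\ A]. *)
Lemma weyl_kn_self A X1 X2 X3 X4 : symbil A ->
  weyl g (kn A A) X1 X2 X3 X4 = 2 / (n%:R - 2) * tensorE g A X1 X2 X3 X4.
Proof.
move=> sA; have ricE : ricci g (kn A A)
    = fun X Y => 2 * tr2 g A * A X Y + (- 2) * pow2 g A X Y.
  by do 2!apply/funext=> ?; rewrite ricci_kn // /pow2; ring.
have trE : scal g (kn A A) = 2 * tr2 g A ^+ 2 - 2 * tr2 g (pow2 g A).
  rewrite /scal ricE (tr2_lin A (fun X Y => (- 2) * pow2 g A X Y)).
  by rewrite [tr2 g (fun _ _ => _ * _)]tr2_ctr // ctrZ -tr2_ctr //; ring.
by rewrite /weyl /tensorE trE ricE /kn; field; rewrite n1 n2.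
Qed.

End Weyl.

(** * Derivations induced by endomorphisms, and the contraction of [Q(g, T)] *)

Section Derivations.
Variables (K : fieldType) (n : nat).
Implicit Types (T : tensor4 K n).

Lemma derivation4_lin b T T' a X1 X2 X3 X4 X Y :
  derivation4 b (fun X1 X2 X3 X4 => a * T X1 X2 X3 X4 + T' X1 X2 X3 X4)
    X1 X2 X3 X4 X Y
  = a * derivation4 b T X1 X2 X3 X4 X Y + derivation4 b T' X1 X2 X3 X4 X Y.
Proof. rewrite /derivation4; ring. Qed.

Lemma derivation4_endo_lin b b' T a X1 X2 X3 X4 X Y : multilinear4 T ->
  derivation4 (fun X Y Z => a *: b X Y Z + b' X Y Z) T X1 X2 X3 X4 X Y
  = a * derivation4 b T X1 X2 X3 X4 X Y + derivation4 b' T X1 X2 X3 X4 X Y.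
Proof.
move=> L; rewrite /derivation4.
have [-> _ _ _] := L a (b X Y X1) (b' X Y X1) X1 X2 X3 X4.
have [_ -> _ _] := L a (b X Y X2) (b' X Y X2) X1 X2 X3 X4.
have [_ _ -> _] := L a (b X Y X3) (b' X Y X3) X1 X2 X3 X4.
have [_ _ _ ->] := L a (b X Y X4) (b' X Y X4) X1 X2 X3 X4.
ring.
Qed.

(** The final [+ 0] closes a sum split by [derivation4_endo_lin], whose pattern always has a second
    summand. *)
Lemma derivation4_scale b T x X1 X2 X3 X4 X W : multilinear4 T ->
  derivation4 (fun X Y Z => x *: b X Y Z + 0) T X1 X2 X3 X4 X W
  = x * derivation4 b T X1 X2 X3 X4 X W.
Proof.
move=> L; have T0 := (L (-1) 0 0 _ _ _ _).
rewrite (derivation4_endo_lin b (fun _ _ _ => 0)) // /derivation4.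
have [+ _ _ _] := T0 0 X2 X3 X4; have [_ + _ _] := T0 X1 0 X3 X4.
have [_ _ + _] := T0 X1 X2 0 X4; have [_ _ _ +] := T0 X1 X2 X3 0.
rewrite scaleN1r oppr0 addr0 !mulN1r !addNr => -> -> -> ->; ring.
Qed.

End Derivations.

Section TachibanaContraction.
Variables (K : numFieldType) (n : nat) (G : 'M[K]_n).
Hypotheses (symG : G^T = G) (unitG : G \in unitmx).
Let g : tensor2 K n := form G.
Let sg : symbil g := symbil_form symG.

(** The multiples of [T] come slot by slot: the first slot gives [-n + 1], the second gives [1], and
    the third and fourth together give [-1] by the Bianchi identity. The remaining traces are Ricci
    tensors or vanish by skew-symmetry. *)
Lemma ctr_tachibana (T : tensor4 K n) X X2 X3 X4 : gen_curvature_tensor T ->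
  ctr G (fun Z W => tachibana g T Z X2 X3 X4 X W)
  = - (n%:R - 1) * T X X2 X3 X4
    + g X X4 * ricci g T X2 X3 - g X X3 * ricci g T X2 X4.
Proof.
move=> [L skew pair bianchi].
have skew1 Y1 Y2 Y3 Y4 : T Y1 Y2 Y3 Y4 = - T Y2 Y1 Y3 Y4.
  by rewrite pair skew -pair.
have T1 Y2 Y3 Y4 : linear_form (fun Z => T Z Y2 Y3 Y4).
  by move=> a Z Z'; have [] := L a Z Z' Z Y2 Y3 Y4.
have T2 Y1 Y3 Y4 : linear_form (fun Z => T Y1 Z Y3 Y4).
  by move=> a Z Z'; have [] := L a Z Z' Y1 Z Y3 Y4.
have T3 Y1 Y2 Y4 : linear_form (fun Z => T Y1 Y2 Z Y4).
  by move=> a Z Z'; have [] := L a Z Z' Y1 Y2 Z Y4.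
have T4 Y1 Y2 Y3 : linear_form (fun Z => T Y1 Y2 Y3 Z).
  by move=> a Z Z'; have [] := L a Z Z' Y1 Y2 Y3 Z.
have -> : (fun Z W => tachibana g T Z X2 X3 X4 X W) = (fun Z W =>
    (- T X X2 X3 X4) * g Z W + g X Z * T W X2 X3 X4
    - g X2 W * T Z X X3 X4 + g X X2 * T Z W X3 X4
    - g X3 W * T Z X2 X X4 + g X X3 * T Z X2 W X4
    - g X4 W * T Z X2 X3 X + g X X4 * T Z X2 X3 W).
  apply/funext => Z; apply/funext => W.
  rewrite /tachibana /derivation4 /wedge_endo.
  rewrite (linear_form_sub _ _ _ _ (T1 X2 X3 X4)) (linear_form_sub _ _ _ _ (T2 Z X3 X4)).
  rewrite (linear_form_sub _ _ _ _ (T3 Z X2 X4)) (linear_form_sub _ _ _ _ (T4 Z X2 X3)).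
  by rewrite (sg.2 W Z) (sg.2 W X2) (sg.2 W X3) (sg.2 W X4); ring.
rewrite !(ctrB, ctrD, ctrZ) ctr_self //.
rewrite (ctr_metric unitG X (T1 X2 X3 X4)).
rewrite (ctr_metric_swap symG unitG X2 (T1 X X3 X4)).
rewrite (ctr_metric_swap symG unitG X3 (T1 X2 X X4)).
rewrite (ctr_metric_swap symG unitG X4 (T1 X2 X3 X)).
have ctr0 : ctr G (fun Z W => T Z W X3 X4) = 0.
  apply/eqP; rewrite -eqNr -ctrN -(ctr_swap symG); apply/eqP; congr ctr.
  by do 2!apply/funext => ?; rewrite skew1 opprK.
have ctrR Y : ctr G (fun Z W => T Z X2 W Y) = - ricci g T X2 Y.
  rewrite ricci_ctr // -ctrN; congr ctr; do 2!apply/funext => ?.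
  by rewrite skew.
rewrite ctr0 ctrR -(ricci_ctr symG).
have E2 : T X2 X X3 X4 = - T X X2 X3 X4 by exact: skew1.
have E3 : T X3 X2 X X4 = T X X2 X3 X4 + T X3 X X2 X4.
  apply/eqP; rewrite -subr_eq0 skew1 -opprB opprK oppr_eq0.
  by rewrite -(bianchi X X2 X3 X4); apply/eqP; ring.
have E4 : T X4 X2 X3 X = - T X3 X X2 X4 by rewrite pair skew.
rewrite E2 E3 E4; ring.
Qed.

End TachibanaContraction.

(** * Pointwise algebra of hypersurfaces *)

Section Hypersurface.
Variables (K : numFieldType) (n : nat) (G : 'M[K]_n).
Hypotheses (symG : G^T = G) (unitG : G \in unitmx) (n_gt2 : (2 < n)%N).
Let g : tensor2 K n := form G.
Let sg : symbil g := symbil_form symG.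
Variables (H : tensor2 K n) (sH : symbil H) (psi rho : K).

Let t := tr2 g H.
Let H2 := pow2 g H.
Hypothesis H3E : forall X Y,
  pow3 g H X Y = t * H2 X Y + psi * H X Y + rho * g X Y.

(* Up to the sign [eps] and a multiple of [g], this is the Ricci tensor. *)
Definition ricci_part : tensor2 K n := fun X Y => t * H X Y - H2 X Y.

Local Notation A := ricci_part.
Local Notation eH := (endo g H).
Local Notation eA := (endo g A).

Let sH2 : symbil H2 := symbil_pow2 symG unitG sH.

Lemma symbil_ricci_part : symbil A.
Proof.
split=> [a X Y Z|X Y]; rewrite /A; last by rewrite sH.2 sH2.2.
by rewrite sH.1 sH2.1; ring.
Qed.

Let sA := symbil_ricci_part.
Let a := tr2 g A.

Let gE B X Y : symbil B -> g (endo g B X) Y = B X Y.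
Proof. exact: (endoP unitG). Qed.

Let gg X : endo g g X = X.
Proof. exact: (endo_self symG unitG). Qed.

Lemma ricci_part_endo X Y : A (eH X) Y = - psi * H X Y - rho * g X Y.
Proof.
rewrite /A -/(H2 X Y) -[H2 (eH X) Y]/(pow3 g H X Y) H3E.
by rewrite -[H (eH X) Y]/(H2 X Y); ring.
Qed.

Lemma endo_ricci_part X Y : H (eA X) Y = - psi * H X Y - rho * g X Y.
Proof. by rewrite (endo_adj symG unitG X Y sH sA) sA.2 ricci_part_endo sH.2 sg.2. Qed.

Lemma pow2E X Y : H2 X Y = t * H X Y - A X Y.
Proof. by rewrite /A opprB addrC subrK. Qed.

Lemma endoHH X Y : H (eH X) Y = t * H X Y - A X Y.
Proof. exact: pow2E. Qed.

Definition half_kn : tensor4 K n := fun X1 X2 X3 X4 =>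
  H X1 X4 * H X2 X3 - H X1 X3 * H X2 X4.

(* The endomorphisms of the curvature-like tensors [half_kn] and [kn g A]. *)
Definition endoH X W Z := H W Z *: eH X - H X Z *: eH W.

Definition endoA X W Z :=
  (g W Z *: eA X - g X Z *: eA W) + (A W Z *: X - A X Z *: W).

(* The actions of [endoH] and [endoA] on [H]; the terms in [rho] cancel in the
   second one. *)
Definition dotH X1 X2 X W : K :=
  - H W X1 * H2 X X2 + H X X1 * H2 W X2 - H W X2 * H2 X X1 + H X X2 * H2 W X1.

Definition dotA X1 X2 X W : K :=
  psi * (g W X1 * H X X2 - g X X1 * H W X2 + g W X2 * H X X1 - g X X2 * H W X1)
  - (A W X1 * H X X2 - A X X1 * H W X2 + A W X2 * H X X1 - A X X2 * H W X1).

(** Leibniz rule: the action on [half_kn] is determined by the action [d] on [H]. *)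
Lemma derivation_half_kn b d X1 X2 X3 X4 X W :
  (forall Y1 Y2, - H (b X W Y1) Y2 - H Y1 (b X W Y2) = d Y1 Y2 X W) ->
  derivation4 b half_kn X1 X2 X3 X4 X W
  = d X1 X4 X W * H X2 X3 + H X1 X4 * d X2 X3 X W
    - d X1 X3 X W * H X2 X4 - H X1 X3 * d X2 X4 X W.
Proof. by move=> dE; rewrite -!dE /derivation4 /half_kn; ring. Qed.

Lemma endoH_dotH X W X1 X2 :
  - H (endoH X W X1) X2 - H X1 (endoH X W X2) = dotH X1 X2 X W.
Proof.
rewrite /endoH !(symbilE sH) (sH.2 X1 (eH _)) (sH.2 X1 (eH _)) /dotH.
by rewrite -![H (eH _) _]/(H2 _ _); ring.
Qed.

Lemma endoA_dotA X W X1 X2 :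
  - H (endoA X W X1) X2 - H X1 (endoA X W X2) = dotA X1 X2 X W.
Proof.
rewrite /endoA !(symbilE sH) !(sH.2 X1) !endo_ricci_part /dotA; ring.
Qed.

Lemma ctr_ricci_part : tr2 g H2 = t * t - a.
Proof.
rewrite /a (_ : A = fun X Y => (- 1) * H2 X Y + t * H X Y); last first.
  by do 2!apply/funext => ?; rewrite /A; ring.
rewrite tr2_lin // [tr2 g (fun _ _ => _ * _)]tr2_ctr // ctrZ -tr2_ctr //.
rewrite -/t; ring.
Qed.

Lemma ctr_product B B' X Y : symbil B -> symbil B' ->
  ctr G (fun Z W => B X Z * B' W Y) = B' (endo g B X) Y.
Proof. by move=> sB sB'; exact: (ctr_symbil unitG X sB (linear_symbill sB' Y)). Qed.

(** The four traces are [- t H^2], two cubic terms of opposite sign, and [tr(H^2) H]. *)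
Lemma ctr_dotH X Y : ctr G (fun Z W => dotH Z Y X W)
  = (t * t - a) * H X Y - t * H2 X Y.
Proof.
have -> : (fun Z W => dotH Z Y X W) = (fun Z W =>
   (- H2 X Y) * H Z W + H X Z * H2 W Y - H (eH X) Z * H W Y + H X Y * H2 Z W).
  apply/funext => Z; apply/funext => W; rewrite /dotH (sH.2 W Z) (sH2.2 W Z).
  by rewrite -[H (eH X) Z]/(H2 X Z); ring.
rewrite !(ctrB, ctrD, ctrZ) !ctr_product // -!tr2_ctr // ctr_ricci_part -/t.
by rewrite -[H (eH (eH X)) Y]/(H2 (eH X) Y); ring.
Qed.

Lemma ctr_dotA X Y : ctr G (fun Z W => dotA Z Y X W)
  = psi * (n%:R * H X Y - t * g X Y) - a * H X Y + t * A X Y.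
Proof.
have -> : (fun Z W => dotA Z Y X W) = (fun Z W =>
    psi * (H X Y * g Z W - g X Z * H W Y + H X Z * g W Y - g X Y * H Z W)
    - (H X Y * A Z W - A X Z * H W Y + H X Z * A W Y - A X Y * H Z W)).
  apply/funext => Z; apply/funext => W.
  by rewrite /dotA (sg.2 W Z) (sH.2 W Z) (sA.2 W Z); ring.
rewrite !(ctrB, ctrD, ctrZ) !ctr_product // -!tr2_ctr // tr2_metric // -/t -/a.
rewrite gg gE // ricci_part_endo endo_ricci_part.
by rewrite [tr2 _ H2]ctr_ricci_part; ring.
Qed.

(** The traced slot [Z] lies either in [d], which gives [c], or in [H]; in the latter case
    contraction puts the image under [eH] in the place of [W]. *)
Lemma ctr_derivation_half_kn b d c X X2 X3 X4 :
  (forall W Y1 Y2, - H (b X W Y1) Y2 - H Y1 (b X W Y2) = d Y1 Y2 X W) ->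
  (forall Y1 Y2, linear_form (d Y1 Y2 X)) ->
  (forall Y, ctr G (fun Z W => d Z Y X W) = c Y) ->
  ctr G (fun Z W => derivation4 b half_kn Z X2 X3 X4 X W)
  = c X4 * H X2 X3 + d X2 X3 X (eH X4) - c X3 * H X2 X4 - d X2 X4 X (eH X3).
Proof.
move=> dE Ld cE.
have -> : (fun Z W => derivation4 b half_kn Z X2 X3 X4 X W) = (fun Z W =>
    H X2 X3 * d Z X4 X W + H X4 Z * d X2 X3 X W
    - H X2 X4 * d Z X3 X W - H X3 Z * d X2 X4 X W).
  apply/funext => Z; apply/funext => W.
  rewrite (derivation_half_kn (d := d)) //.
  by rewrite (sH.2 Z X4) (sH.2 Z X3); ring.
rewrite !(ctrB, ctrD, ctrZ) !cE.
rewrite (ctr_symbil unitG _ sH (Ld X2 X3)).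
rewrite (ctr_symbil unitG _ sH (Ld X2 X4)); ring.
Qed.

Lemma linear_dotH Y1 Y2 X : linear_form (dotH Y1 Y2 X).
Proof. by move=> b W W'; rewrite /dotH !(sH.1, sH2.1); ring. Qed.

Lemma linear_dotA Y1 Y2 X : linear_form (dotA Y1 Y2 X).
Proof. by move=> b W W'; rewrite /dotA !(sH.1, sg.1, sA.1); ring. Qed.

Lemma symbil_ricci T : gen_curvature_tensor T -> symbil (ricci g T).
Proof.
move=> [L skew pair _]; split=> [b X Y Z|X Y].
  rewrite !ricci_ctr // -ctrZ -ctrD; congr ctr.
  apply/funext => V; apply/funext => W.
  by have [_ -> _ _] := L b X Y V X Z W.
rewrite !ricci_ctr // -(ctr_swap symG); congr ctr; do 2!apply/funext => ?.
by rewrite pair skew pair skew opprK pair.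
Qed.

Let n1 : n%:R - 1 != 0 :> K := natrB_neq0 K (ltnW n_gt2).

(* The contraction of [tachibana g T] is skew-symmetrized in its first two
   arguments, which turns its right-hand side into Kulkarni-Nomizu products. *)
Lemma tachibana_solution T al be y0 B0 :
  gen_curvature_tensor T -> symbil B0 ->
  (forall X1 X2 X3 X4 X W, tachibana g T X1 X2 X3 X4 X W
     = al * derivation4 endoH half_kn X1 X2 X3 X4 X W
       + be * derivation4 endoA half_kn X1 X2 X3 X4 X W
       + tachibana g (fun X1 X2 X3 X4 => y0 * kn H H X1 X2 X3 X4 + kn g B0 X1 X2 X3 X4)
           X1 X2 X3 X4 X W) ->
  exists2 B, symbil B & T = fun X1 X2 X3 X4 =>
    - (al + be) / (2 * (n%:R - 1)) * kn A A X1 X2 X3 X4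
    + ((y0 + (al * (a + psi) + be * (a - (n%:R - 2) * psi)) / (2 * (n%:R - 1)))
        * kn H H X1 X2 X3 X4 + kn g B X1 X2 X3 X4).
Proof.
move=> gT sB0 TE; pose T0 : tensor4 K n := fun X1 X2 X3 X4 =>
  y0 * kn H H X1 X2 X3 X4 + kn g B0 X1 X2 X3 X4.
(* [T0] already has the desired shape; removing it leaves only the actions of [endoH] and [endoA] to
   be contracted. *)
pose T' : tensor4 K n := fun X1 X2 X3 X4 => (- 1) * T0 X1 X2 X3 X4 + T X1 X2 X3 X4.
have gT' : gen_curvature_tensor T' by apply/gct_lin/gT/gct_lin; exact: gct_kn.
have T'E X1 X2 X3 X4 X W : tachibana g T' X1 X2 X3 X4 X W
     = al * derivation4 endoH half_kn X1 X2 X3 X4 X W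
       + be * derivation4 endoA half_kn X1 X2 X3 X4 X W.
  by rewrite /tachibana derivation4_lin -!/(tachibana _ _ _ _ _ _ _ _) TE /T0; ring.
have C X X2 X3 X4 : - (n%:R - 1) * T' X X2 X3 X4
    + g X X4 * ricci g T' X2 X3 - g X X3 * ricci g T' X2 X4
  = al * (((t * t - a) * H X X4 - t * H2 X X4) * H X2 X3 + dotH X2 X3 X (eH X4)
      - ((t * t - a) * H X X3 - t * H2 X X3) * H X2 X4 - dotH X2 X4 X (eH X3))
    + be * ((psi * (n%:R * H X X4 - t * g X X4) - a * H X X4 + t * A X X4) * H X2 X3
      + dotA X2 X3 X (eH X4)
      - (psi * (n%:R * H X X3 - t * g X X3) - a * H X X3 + t * A X X3) * H X2 X4
      - dotA X2 X4 X (eH X3)).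
  rewrite -(ctr_tachibana symG unitG _ _ _ _ gT').
  have := ctr_derivation_half_kn
    (c := fun Y => (t * t - a) * H X Y - t * H2 X Y) X2 X3 X4 (endoH_dotH X)
    (fun Y1 Y2 => linear_dotH Y1 Y2 X) (ctr_dotH X).
  have := ctr_derivation_half_kn
    (c := fun Y => psi * (n%:R * H X Y - t * g X Y) - a * H X Y + t * A X Y)
    X2 X3 X4 (endoA_dotA X)
    (fun Y1 Y2 => linear_dotA Y1 Y2 X) (ctr_dotA X).
  move=> /= <- <-; rewrite -!ctrZ -ctrD; congr ctr.
  by apply/funext => Z; apply/funext => W; rewrite T'E.
(* The Ricci term comes from the left-hand side of [C], the multiples of [H] and [A] gather the
   terms with a factor [g] on its right-hand side, and [B0] is restored from [T0]. *)
pose B : tensor2 K n := fun X Y => (2 * (n%:R - 1))^-1 * ricci g T' X Y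
  + ((al + be) * rho / (2 * (n%:R - 1)) * H X Y
     + (be * psi / (2 * (n%:R - 1)) * A X Y + B0 X Y)).
exists B.
  apply: symbil_lin; first exact: symbil_ricci.
  by apply: symbil_lin => //; apply: symbil_lin.
apply/funext=> X; apply/funext=> X2; apply/funext=> X3; apply/funext=> X4.
have skew1 : T' X2 X X3 X4 = - T' X X2 X3 X4.
  by have [_ skew pair _] := gT'; rewrite pair skew -pair.
have C1 := C X X2 X3 X4; have := C X2 X X3 X4; rewrite skew1 => C2.
have TT' : T X X2 X3 X4 = T' X X2 X3 X4 + T0 X X2 X3 X4 by rewrite /T'; ring.
rewrite TT' /T0.
move: C1 C2; rewrite /dotH /dotA.
rewrite !(pow2E (eH _)) ![H (eH _) _]endoHH !ricci_part_endo !pow2E !gE //.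
rewrite (sH.2 X3 X2) (sH.2 X4 X2) (sH.2 X4 X3) (sH.2 X3 X) (sH.2 X4 X) (sH.2 X2 X).
rewrite (sA.2 X3 X2) (sA.2 X4 X2) (sA.2 X4 X3) (sA.2 X3 X) (sA.2 X4 X) (sA.2 X2 X).
rewrite (sg.2 X3 X2) (sg.2 X4 X2) (sg.2 X4 X3) (sg.2 X3 X) (sg.2 X4 X) (sg.2 X2 X).
move=> C1 C2; apply: (mulfI (x := 2 * (n%:R - 1))).
  by rewrite mulf_neq0 ?pnatr_eq0.
set q := T' X X2 X3 X4 in C1 C2 *.
(* The two instances of [C] carry [T'] with opposite signs, so their difference isolates
   [2(n-1) T']. *)
have E (m p r r' x s s' y : K) : - m * p + r - r' = x -> - m * - p + s - s' = y ->
    2 * m * p = (r - r' - x) - (s - s' - y) by move=> <- <-; ring.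
rewrite mulrDr (E _ _ _ _ _ _ _ _ C1 C2) /kn /B.
by field; rewrite n1.
Qed.

(** * The actions [R.C] and [C.R] for a hypersurface of a space form *)

Variables (c eps : K) (Rt : tensor4 K n).
Hypotheses (eps2 : eps * eps = 1) (RtE : Rt = fun X1 X2 X3 X4 =>
  c / 2 * kn g g X1 X2 X3 X4 + eps / 2 * kn H H X1 X2 X3 X4).

Let S := ricci g Rt.
Let kap := scal g Rt.
Let C := weyl g Rt.
(* [curv_endo g C] is [lam] times the wedge endomorphism plus [endoH] and [endoA]
   terms. *)
Let lam := c - 2 * (n%:R - 1) * c / (n%:R - 2)
  + kap / ((n%:R - 1) * (n%:R - 2)).

Let n2 : n%:R - 2 != 0 :> K := natrB_neq0 K n_gt2.

Lemma hypersurface_ricci : S = fun X Y => eps * A X Y + (n%:R - 1) * c * g X Y.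
Proof.
apply/funext => X; apply/funext => Y; rewrite /S RtE ricci_ctr // ctrD !ctrZ.
rewrite -!(ricci_ctr symG) ricci_kn_metric // (ricci_kn symG unitG X Y sH sH).
by rewrite tr2_metric // /A /t /H2 /pow2 /g; field.
Qed.

Lemma hypersurface_scal : kap = eps * a + n%:R * (n%:R - 1) * c.
Proof.
rewrite /kap /scal -/S hypersurface_ricci.
rewrite (tr2_lin symG A (fun X Y => (n%:R - 1) * c * g X Y)) -/a.
by rewrite [tr2 g (fun _ _ => _ * _)]tr2_ctr // ctrZ ctr_self //; ring.
Qed.

Lemma hypersurface_weyl : C = fun X1 X2 X3 X4 => lam / 2 * kn g g X1 X2 X3 X4
  + (eps / 2 * kn H H X1 X2 X3 X4 + (- eps / (n%:R - 2)) * kn g A X1 X2 X3 X4).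
Proof.
apply/funext => X1; apply/funext => X2; apply/funext => X3; apply/funext => X4.
rewrite /C /weyl -/S -/kap hypersurface_ricci RtE /lam /kn.
by field; rewrite n1 n2.
Qed.

(** Because [S = eps A + m g] and [eps / 2 * H /\ H] is [Rt] up to [g /\ g], passing to [S] and [Rt]
    changes the tensor only by products with [g]; [B'] collects them. *)
Lemma weyl_combination x y B X1 X2 X3 X4 : symbil B ->
  weyl g (fun X1 X2 X3 X4 => x * kn A A X1 X2 X3 X4
    + (y * kn H H X1 X2 X3 X4 + kn g B X1 X2 X3 X4)) X1 X2 X3 X4
  = 2 * x / (n%:R - 2) * tensorE g S X1 X2 X3 X4 + 2 * eps * y * C X1 X2 X3 X4.
Proof.
move=> sB; pose m := (n%:R - 1) * c; pose B' : tensor2 K n := fun X Y =>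
  (- (2 * x * eps * m)) * A X Y + ((- (x * m ^+ 2 + eps * y * c)) * g X Y + B X Y).
have sB' : symbil B' by apply: symbil_lin => //; exact: symbil_lin.
have sS : symbil S.
  rewrite hypersurface_ricci; apply: symbil_lin => //.
  rewrite (_ : (fun X Y => m * g X Y) = fun X Y => m * g X Y + 0); last first.
    by do 2!apply/funext => ?; rewrite addr0.
  exact: symbil_lin sg (symbil0 K n).
have -> : (fun X1 X2 X3 X4 => x * kn A A X1 X2 X3 X4
    + (y * kn H H X1 X2 X3 X4 + kn g B X1 X2 X3 X4)) =
   (fun X1 X2 X3 X4 => x * kn S S X1 X2 X3 X4
    + (2 * eps * y * Rt X1 X2 X3 X4 + kn g B' X1 X2 X3 X4)).
  apply/funext => Y1; apply/funext => Y2; apply/funext => Y3; apply/funext => Y4.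
  rewrite hypersurface_ricci RtE /kn /B' -/m.
  (* [field] does not know that [eps * eps = 1], so the factor is inserted by hand where it is
     needed. *)
  have e2 z : eps * eps * z = z by rewrite eps2 mul1r.
  rewrite -[x * (A Y1 Y4 * _ + _ - _ - _)]e2 -[y * (H Y1 Y4 * _ + _ - _ - _)]e2.
  by field.
rewrite (weyl_lin symG (kn S S)
  (fun X1 X2 X3 X4 => 2 * eps * y * Rt X1 X2 X3 X4 + kn g B' X1 X2 X3 X4)).
rewrite (weyl_lin symG Rt (kn g B')) weyl_kn_metric // weyl_kn_self // -/C addr0.
by field.
Qed.

Lemma g_endoH X W Y1 Y2 : g Y1 (endoH X W Y2) = - g (endoH X W Y1) Y2.
Proof. by rewrite /endoH !(symbilE sg) !(sg.2 Y1) !gE //; ring. Qed.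

Lemma g_endoA X W Y1 Y2 : g Y1 (endoA X W Y2) = - g (endoA X W Y1) Y2.
Proof.
rewrite /endoA !(symbilE sg) (sg.2 Y1 (eA X)) (sg.2 Y1 (eA W)) !(gE _ _ sA).
by rewrite (sg.2 Y1 X) (sg.2 Y1 W); ring.
Qed.

Lemma g_wedge X W Y1 Y2 :
  g Y1 (wedge_endo g X W Y2) = - g (wedge_endo g X W Y1) Y2.
Proof. by rewrite /wedge_endo !(symbilE sg) !(sg.2 Y1); ring. Qed.

(** An endomorphism that is skew for [g] annihilates [g], so only the factor [B] is acted on. *)
Lemma derivation_kn_metric b B X1 X2 X3 X4 X W :
  (forall Y1 Y2, g Y1 (b X W Y2) = - g (b X W Y1) Y2) ->
  let d Y1 Y2 := - B (b X W Y1) Y2 - B Y1 (b X W Y2) in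
  derivation4 b (kn g B) X1 X2 X3 X4 X W =
    g X1 X4 * d X2 X3 + g X2 X3 * d X1 X4 - g X1 X3 * d X2 X4 - g X2 X4 * d X1 X3.
Proof. by move=> bE d; rewrite /derivation4 /kn !bE /d; ring. Qed.

Lemma derivation_kn_metric0 b X1 X2 X3 X4 X W :
  (forall Y1 Y2, g Y1 (b X W Y2) = - g (b X W Y1) Y2) ->
  derivation4 b (kn g g) X1 X2 X3 X4 X W = 0.
Proof. by move=> bE; rewrite derivation_kn_metric // !bE; ring. Qed.

(** By [ricci_part_endo], the action of [endoH] on [A] has a [psi] part that cancels by symmetry and
    a [rho] part equal to [rho Q(g, H)]. *)
Lemma derivation_endoH_kn X1 X2 X3 X4 X W :
  derivation4 endoH (kn g A) X1 X2 X3 X4 X W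
  = rho * tachibana g (kn g H) X1 X2 X3 X4 X W.
Proof.
rewrite /tachibana !derivation_kn_metric; [|exact: g_wedge|exact: g_endoH].
pose d Y1 Y2 := - H (wedge_endo g X W Y1) Y2 - H Y1 (wedge_endo g X W Y2).
have dE Y1 Y2 : - A (endoH X W Y1) Y2 - A Y1 (endoH X W Y2) = rho * d Y1 Y2.
  rewrite /d /endoH /wedge_endo !(symbilE sA) !(symbilE sH).
  rewrite !(sA.2 Y1) !ricci_part_endo !(sH.2 Y1); ring.
by rewrite !dE -/(d X2 X3) -/(d X1 X4) -/(d X2 X4) -/(d X1 X3); ring.
Qed.

Lemma derivation_kn_half b X1 X2 X3 X4 X W :
  derivation4 b (kn H H) X1 X2 X3 X4 X W
  = 2 * derivation4 b half_kn X1 X2 X3 X4 X W.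
Proof. by rewrite /derivation4 /kn /half_kn; ring. Qed.

Lemma curv_endo_Rt X W Z :
  curv_endo g Rt X W Z = c *: wedge_endo g X W Z + (eps *: endoH X W Z + 0).
Proof.
apply: sharp_unique => // Y; rewrite RtE addr0 !formDl !formZl -/g.
rewrite /wedge_endo /endoH !(symbilE sg) !gE // /kn.
by field.
Qed.

Lemma curv_endo_weyl X W Z : curv_endo g C X W Z = lam *: wedge_endo g X W Z
  + (eps *: endoH X W Z + (- eps / (n%:R - 2)) *: endoA X W Z).
Proof.
apply: sharp_unique => // Y; rewrite hypersurface_weyl !formDl !formZl -/g.
rewrite /wedge_endo /endoH /endoA !(symbilE sg) !(gE _ _ sH) !(gE _ _ sA).
rewrite /kn; by field.
Qed.

Lemma gct_weyl : gen_curvature_tensor C.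
Proof.
rewrite hypersurface_weyl; apply: gct_lin; first exact: gct_kn.
by apply: gct_lin; [exact: gct_kn|apply/gct_scale/gct_kn].
Qed.

Lemma gct_curvature : gen_curvature_tensor Rt.
Proof. by rewrite RtE; apply: gct_lin; [|apply: gct_scale]; exact: gct_kn. Qed.

(** The wedge part of [R] gives [c Q(g, C)]. Its part [eps endoH] kills [g /\ g], meets [H /\ H]
    with total sign [eps^2 = 1], and meets [g /\ A] through [derivation_endoH_kn]. *)
Lemma curv_dot_curvature_weyl X1 X2 X3 X4 X W :
  curv_dot g Rt C X1 X2 X3 X4 X W = c * tachibana g C X1 X2 X3 X4 X W
    + derivation4 endoH half_kn X1 X2 X3 X4 X W
    - rho / (n%:R - 2) * tachibana g (kn g H) X1 X2 X3 X4 X W.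
Proof.
have [L _ _ _] := gct_weyl; rewrite /curv_dot.
have -> : curv_endo g Rt = fun X W Z =>
    c *: wedge_endo g X W Z + (fun X W Z => eps *: endoH X W Z + 0) X W Z.
  by do 3!apply/funext => ?; rewrite curv_endo_Rt.
rewrite derivation4_endo_lin // derivation4_scale // -/(tachibana g C _ _ _ _ _ _).
have -> : derivation4 endoH C X1 X2 X3 X4 X W
    = eps * derivation4 endoH half_kn X1 X2 X3 X4 X W
      - eps / (n%:R - 2) * rho * tachibana g (kn g H) X1 X2 X3 X4 X W.
  rewrite hypersurface_weyl (derivation4_lin _ (kn g g) (fun X1 X2 X3 X4 =>
    eps / 2 * kn H H X1 X2 X3 X4 + (- eps / (n%:R - 2)) * kn g A X1 X2 X3 X4)).
  rewrite derivation_kn_metric0; last exact: g_endoH.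
  rewrite (derivation4_lin _ (kn H H) (fun X1 X2 X3 X4 =>
    (- eps / (n%:R - 2)) * kn g A X1 X2 X3 X4)) derivation_kn_half.
  have -> : derivation4 endoH
      (fun X1 X2 X3 X4 => (- eps / (n%:R - 2)) * kn g A X1 X2 X3 X4) X1 X2 X3 X4 X W
      = (- eps / (n%:R - 2)) * derivation4 endoH (kn g A) X1 X2 X3 X4 X W.
    by rewrite /derivation4; ring.
  by rewrite derivation_endoH_kn; field.
have e2 z : eps * eps * z = z by rewrite eps2 mul1r.
rewrite -[derivation4 endoH half_kn _ _ _ _ _ _ in RHS]e2.
by rewrite -[rho / _ * _ in RHS]e2; field.
Qed.

(** Here [endoH] and [endoA] see only the part of [R] in [H /\ H], as both are skew for [g]. *)
Lemma curv_dot_weyl_curvature X1 X2 X3 X4 X W :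
  curv_dot g C Rt X1 X2 X3 X4 X W = lam * tachibana g Rt X1 X2 X3 X4 X W
    + derivation4 endoH half_kn X1 X2 X3 X4 X W
    - (n%:R - 2)^-1 * derivation4 endoA half_kn X1 X2 X3 X4 X W.
Proof.
have [L _ _ _] := gct_curvature; rewrite /curv_dot.
have -> : curv_endo g C = fun X W Z => lam *: wedge_endo g X W Z
    + (fun X W Z => eps *: endoH X W Z
        + (fun X W Z => (- eps / (n%:R - 2)) *: endoA X W Z + 0) X W Z) X W Z.
  by do 3!apply/funext => ?; rewrite curv_endo_weyl addr0.
rewrite derivation4_endo_lin // derivation4_endo_lin // derivation4_scale //.
rewrite -/(tachibana g Rt _ _ _ _ _ _).
have DE b : (forall Y1 Y2, g Y1 (b X W Y2) = - g (b X W Y1) Y2) ->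
    derivation4 b Rt X1 X2 X3 X4 X W = eps * derivation4 b half_kn X1 X2 X3 X4 X W.
  move=> bE; rewrite RtE (derivation4_lin _ (kn g g) (fun X1 X2 X3 X4 =>
    eps / 2 * kn H H X1 X2 X3 X4)) derivation_kn_metric0 //.
  by rewrite /derivation4 /half_kn /kn; field.
rewrite (DE _ (g_endoH X W)) (DE _ (g_endoA X W)).
have e2 z : eps * eps * z = z by rewrite eps2 mul1r.
rewrite -[derivation4 endoH half_kn _ _ _ _ _ _ in RHS]e2.
by rewrite -[_^-1 * _ in RHS]e2; field.
Qed.

Let epsa : eps * a = kap - n%:R * (n%:R - 1) * c.
Proof. by rewrite hypersurface_scal addrK. Qed.

(** Modulo products with [g], [y * eps / 2 * H /\ H] is [y C]; this is why [y] reappears unchanged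
    before [C]. The trace [a] is eliminated by [epsa]. *)
Lemma weyl_solution T al be y B0 X1 X2 X3 X4 :
  gen_curvature_tensor T -> symbil B0 ->
  (forall X1 X2 X3 X4 X W, tachibana g T X1 X2 X3 X4 X W
     = al * derivation4 endoH half_kn X1 X2 X3 X4 X W
       + be * derivation4 endoA half_kn X1 X2 X3 X4 X W
       + tachibana g (fun X1 X2 X3 X4 => y * eps / 2 * kn H H X1 X2 X3 X4
           + kn g B0 X1 X2 X3 X4) X1 X2 X3 X4 X W) ->
  weyl g T X1 X2 X3 X4 =
    (y + (al * (kap - n%:R * (n%:R - 1) * c + eps * psi)
          + be * (kap - n%:R * (n%:R - 1) * c - (n%:R - 2) * (eps * psi)))
         / (n%:R - 1)) * C X1 X2 X3 X4
    - (al + be) / ((n%:R - 1) * (n%:R - 2)) * tensorE g S X1 X2 X3 X4.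
Proof.
move=> gT sB0 /(tachibana_solution gT sB0)[B sB ->].
have yE : y = eps * eps * y by rewrite eps2 mul1r.
rewrite weyl_combination // -!epsa [in RHS]yE.
by field; rewrite n1 n2.
Qed.

(** [B1] and [B2] are the factors left beside [g] when [c C - rho/(n-2) g /\ H] and [lam R] are
    reduced to multiples of [H /\ H]; the trailing [0] suits [symbil_lin]. *)
Let B1 : tensor2 K n := fun X Y => c * lam / 2 * g X Y
  + (- (c * eps / (n%:R - 2)) * A X Y + (- (rho / (n%:R - 2)) * H X Y + 0)).
Let B2 : tensor2 K n := fun X Y => lam * c / 2 * g X Y + 0.

Let sB1 : symbil B1.
Proof.
do 2!apply: symbil_lin => //; apply: symbil_lin => //; exact: symbil0.
Qed.

Let sB2 : symbil B2.
Proof. by apply: symbil_lin => //; exact: symbil0. Qed.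

Let T1E X1 X2 X3 X4 X W : c * tachibana g C X1 X2 X3 X4 X W
    - rho / (n%:R - 2) * tachibana g (kn g H) X1 X2 X3 X4 X W
  = tachibana g (fun X1 X2 X3 X4 => c * eps / 2 * kn H H X1 X2 X3 X4
      + kn g B1 X1 X2 X3 X4) X1 X2 X3 X4 X W.
Proof.
have -> : (fun X1 X2 X3 X4 => c * eps / 2 * kn H H X1 X2 X3 X4 + kn g B1 X1 X2 X3 X4)
    = fun X1 X2 X3 X4 => c * C X1 X2 X3 X4 - rho / (n%:R - 2) * kn g H X1 X2 X3 X4.
  by do 4!apply/funext => ?; rewrite hypersurface_weyl /B1 /kn; field.
by rewrite /tachibana /derivation4; ring.
Qed.

Let T2E X1 X2 X3 X4 X W : lam * tachibana g Rt X1 X2 X3 X4 X W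
  = tachibana g (fun X1 X2 X3 X4 => lam * eps / 2 * kn H H X1 X2 X3 X4
      + kn g B2 X1 X2 X3 X4) X1 X2 X3 X4 X W.
Proof.
have -> : (fun X1 X2 X3 X4 => lam * eps / 2 * kn H H X1 X2 X3 X4 + kn g B2 X1 X2 X3 X4)
    = fun X1 X2 X3 X4 => lam * Rt X1 X2 X3 X4.
  by do 4!apply/funext => ?; rewrite RtE /B2 /kn; field.
by rewrite /tachibana /derivation4; ring.
Qed.

Let T3E X1 X2 X3 X4 X W : c * tachibana g C X1 X2 X3 X4 X W
    - rho / (n%:R - 2) * tachibana g (kn g H) X1 X2 X3 X4 X W
    - lam * tachibana g Rt X1 X2 X3 X4 X W
  = tachibana g (fun X1 X2 X3 X4 => (c - lam) * eps / 2 * kn H H X1 X2 X3 X4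
      + kn g (fun X Y => - 1 * B2 X Y + B1 X Y) X1 X2 X3 X4) X1 X2 X3 X4 X W.
Proof.
rewrite T1E T2E /tachibana.
pose F1 : tensor4 K n := fun X1 X2 X3 X4 => c * eps / 2 * kn H H X1 X2 X3 X4
  + kn g B1 X1 X2 X3 X4.
pose F2 : tensor4 K n := fun X1 X2 X3 X4 => lam * eps / 2 * kn H H X1 X2 X3 X4
  + kn g B2 X1 X2 X3 X4.
rewrite -/F1 -/F2.
have -> : (fun X1 X2 X3 X4 => (c - lam) * eps / 2 * kn H H X1 X2 X3 X4
      + kn g (fun X Y => - 1 * B2 X Y + B1 X Y) X1 X2 X3 X4)
    = fun X1 X2 X3 X4 => - 1 * F2 X1 X2 X3 X4 + F1 X1 X2 X3 X4.
  by do 4!apply/funext => ?; rewrite /F1 /F2 /kn; ring.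
by rewrite (derivation4_lin _ F2 F1) mulN1r addrC.
Qed.

Lemma weyl_of_curvature_weyl T X1 X2 X3 X4 : gen_curvature_tensor T ->
  (forall X1 X2 X3 X4 X W,
     curv_dot g Rt C X1 X2 X3 X4 X W = tachibana g T X1 X2 X3 X4 X W) ->
  weyl g T X1 X2 X3 X4 = ((kap + eps * psi) / (n%:R - 1) - (n%:R - 1) * c)
      * C X1 X2 X3 X4
    - ((n%:R - 2) * (n%:R - 1))^-1 * tensorE g S X1 X2 X3 X4.
Proof.
move=> gT TE; rewrite (weyl_solution (al := 1) (be := 0) (y := c) _ _ _ _ gT sB1).
  by field; rewrite n1 n2.
by move=> *; rewrite -TE curv_dot_curvature_weyl -T1E; ring.
Qed.

(** The term of [lam] in [kap] cancels the one produced by [be], and the terms in [c] add up to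
    [- n c]. *)
Lemma weyl_of_weyl_curvature T X1 X2 X3 X4 : gen_curvature_tensor T ->
  (forall X1 X2 X3 X4 X W,
     curv_dot g C Rt X1 X2 X3 X4 X W = tachibana g T X1 X2 X3 X4 X W) ->
  weyl g T X1 X2 X3 X4 = ((kap + 2 * eps * psi) / (n%:R - 1) - n%:R * c)
      * C X1 X2 X3 X4
    - (n%:R - 3) / ((n%:R - 2) ^+ 2 * (n%:R - 1)) * tensorE g S X1 X2 X3 X4.
Proof.
move=> gT TE; rewrite (weyl_solution (al := 1) (be := - (n%:R - 2)^-1) (y := lam)
  _ _ _ _ gT sB2).
  by rewrite /lam; field; rewrite n1 n2.
by move=> *; rewrite -TE curv_dot_weyl_curvature -T2E; ring.
Qed.

(** The [endoH] terms of the two actions cancel, so only [endoA] and a term [Q(g, .)] remain. *)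
Lemma weyl_of_commutator T X1 X2 X3 X4 : gen_curvature_tensor T ->
  (forall X1 X2 X3 X4 X W,
     curv_dot g Rt C X1 X2 X3 X4 X W - curv_dot g C Rt X1 X2 X3 X4 X W
     = tachibana g T X1 X2 X3 X4 X W) ->
  weyl g T X1 X2 X3 X4 = (c - eps * psi / (n%:R - 1)) * C X1 X2 X3 X4
    - ((n%:R - 2) ^+ 2 * (n%:R - 1))^-1 * tensorE g S X1 X2 X3 X4.
Proof.
move=> gT TE; rewrite (weyl_solution (al := 0) (be := (n%:R - 2)^-1) (y := c - lam)
  _ _ _ _ gT (symbil_lin (-1) sB2 sB1)).
  by rewrite /lam; field; rewrite n1 n2.
move=> *; rewrite -TE curv_dot_curvature_weyl curv_dot_weyl_curvature -T3E; ring.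
Qed.

End Hypersurface.

Theorem theorem8p2 (R : realType) (n s : nat) (hn : (4 <= n)%N)
    (N : manifold R n.+1) (gN : metric N) (kt : R)
    (sigN : has_signature gN s)
    (ccN : constant_curvature gN (kt / (n%:R * (n%:R + 1))))
    (ktE : forall y : N, scalar_curvature gN y = kt)
    (M : manifold R n) (g : metric M)
    (f : M -> N) (isof : isometric_immersion g gN f)
    (eps : R) (epsE : eps = 1 \/ eps = -1)
    (xi : M -> 'rV[R]_n.+1) (xiN : unit_normal gN f xi eps)
    (not_einstein : ~ einstein g)
    (not_conf_flat : ~ conformally_flat g)
    (psi rho : M -> R)
    (T1 T2 T3 : M -> tensor4 R n) :
  let gx := metric_at g in
  let Rx := curvature g in
  let Sx := ricci_curvature g in
  let kappa := scalar_curvature g in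
  let Cx := weyl_curvature g in
  let H := second_fundamental gN f xi in
  let U := UH g H in
  let E := fun x => tensorE (gx x) (Sx x) in
  (forall x, U x -> forall X Y,
     pow3 (gx x) (H x) X Y
     = tr2 (gx x) (H x) * pow2 (gx x) (H x) X Y
       + psi x * H x X Y + rho x * gx x X Y) ->
  (forall x, U x -> gen_curvature_tensor (T1 x)) ->
  (forall x, U x -> gen_curvature_tensor (T2 x)) ->
  (forall x, U x -> gen_curvature_tensor (T3 x)) ->
  [/\ (forall x, U x -> forall X1 X2 X3 X4 X Y,
         curv_dot (gx x) (Rx x) (Cx x) X1 X2 X3 X4 X Y
         = tachibana (gx x) (T1 x) X1 X2 X3 X4 X Y) ->
      (forall x, U x -> forall X1 X2 X3 X4,
         weyl (gx x) (T1 x) X1 X2 X3 X4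
         = ((kappa x + eps * psi x) / (n%:R - 1)
            - (n%:R - 1) * kt / (n%:R * (n%:R + 1))) * Cx x X1 X2 X3 X4
           - ((n%:R - 2) * (n%:R - 1))^-1 * E x X1 X2 X3 X4),
      (forall x, U x -> forall X1 X2 X3 X4 X Y,
         curv_dot (gx x) (Cx x) (Rx x) X1 X2 X3 X4 X Y
         = tachibana (gx x) (T2 x) X1 X2 X3 X4 X Y) ->
      (forall x, U x -> forall X1 X2 X3 X4,
         weyl (gx x) (T2 x) X1 X2 X3 X4
         = ((kappa x + 2 * eps * psi x) / (n%:R - 1)
            - kt / (n%:R + 1)) * Cx x X1 X2 X3 X4
           - (n%:R - 3) / ((n%:R - 2) ^+ 2 * (n%:R - 1)) * E x X1 X2 X3 X4) &
      (forall x, U x -> forall X1 X2 X3 X4 X Y,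
         curv_dot (gx x) (Rx x) (Cx x) X1 X2 X3 X4 X Y
         - curv_dot (gx x) (Cx x) (Rx x) X1 X2 X3 X4 X Y
         = tachibana (gx x) (T3 x) X1 X2 X3 X4 X Y) ->
      (forall x, U x -> forall X1 X2 X3 X4,
         weyl (gx x) (T3 x) X1 X2 X3 X4
         = (kt / (n%:R * (n%:R + 1)) - eps * psi x / (n%:R - 1))
             * Cx x X1 X2 X3 X4
           - ((n%:R - 2) ^+ 2 * (n%:R - 1))^-1 * E x X1 X2 X3 X4)].
Proof.
move=> gx Rx Sx kappa Cx H U E H3E gT1 gT2 gT3.
have eps2 : eps * eps = 1 by case: epsE => ->; rewrite ?mulrNN mulr1.
have n_gt2 : (2 < n)%N by exact: leq_trans hn.
have n0 : n%:R != 0 :> R by rewrite pnatr_eq0 -lt0n (leq_trans _ hn).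
have n1 : n%:R + 1 != 0 :> R by rewrite natr1 pnatr_eq0.
pose c : R := kt / (n%:R * (n%:R + 1)).
(* All that the pointwise algebra takes from the immersion. *)
have geom x : U x -> [/\ (mcomp g x (coord x))^T = mcomp g x (coord x),
    mcomp g x (coord x) \in unitmx, symbil (H x) &
    Rx x = fun X1 X2 X3 X4 => c / 2 * kn (gx x) (gx x) X1 X2 X3 X4
      + eps / 2 * kn (H x) (H x) X1 X2 X3 X4].
  move=> Ux; have cx : ccod (chart_at x) (coord x) by exact/cmap_in/chart_at_dom.
  have [h symh [HE RE]] := gauss_hypersurface isof eps2 xiN ccN x.
  have {}HE : H x = form h := HE.
  split; [exact: mcomp_sym|exact: mcomp_unit|rewrite HE; exact: symbil_form|].
  by do 4!apply/funext => ?; rewrite HE; exact: RE.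
split=> TE x Ux X1 X2 X3 X4; have [sG uG sH RE] := geom x Ux.
- rewrite (weyl_of_curvature_weyl sG uG n_gt2 sH (H3E x Ux) eps2 RE
    X1 X2 X3 X4 (gT1 x Ux) (TE x Ux)).
  by congr ((_ - _) * _ - _); rewrite /c; field; rewrite n0 n1.
- rewrite (weyl_of_weyl_curvature sG uG n_gt2 sH (H3E x Ux) eps2 RE
    X1 X2 X3 X4 (gT2 x Ux) (TE x Ux)).
  by congr ((_ - _) * _ - _); rewrite /c; field; rewrite n0 n1.
- exact: (weyl_of_commutator sG uG n_gt2 sH (H3E x Ux) eps2 RE
    X1 X2 X3 X4 (gT3 x Ux) (TE x Ux)).
Qed.
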